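(* The relaxed problem (P2) under the symmetry constraint is solved by the quality function $q^*_{sym}$ such that, for each $\theta\in[0,1)$, $q=q^*_{sym}(\theta)$ solves $$V'(q)=\tilde C^P_q(q,\theta)+\frac{\tilde C^I_q(q,\theta)}{(1-F(\theta))^{n-1}},$$ together with the allocation functions $z^*_{i,sym}(\bm\theta)=\mathbb I[\theta_i=\theta_{(1)}]$, where $\theta_{(1)}=\min_j\theta_j$. Moreover, $q^*_{sym}$ is decreasing.
   Context: Setting. There are $n$ firms with types $\theta_i\in[0,1]$, i.i.d. with cdf $F$ and strictly positive density $f$. $V:\mathbb R_+\to\mathbb R$ is the buyer's value of quality; $C^P,C^I:\mathbb R_+\times[0,1]\to\mathbb R_+$ are production (winner-pay) and investment (all-pay) costs; all functions are as smooth as needed. Virtual costs: $\tilde C^P=C^P+C^P_\theta F/f$, $\tilde C^I=C^I+C^I_\theta F/f$ (subscripts denote partial derivatives). Standing assumptions. For $q>0$, $\theta\in(0,1)$: $C^P_q,C^P_\theta,C^I_q,C^I_\theta,C^P_{q\theta},C^I_{q\theta}>0$; $C^I(0,\theta)=C^I_q(0,\theta)=0$; $V'\ge0$, $V''\le0$; $\tilde C^P_\theta>0$, $\tilde C^P_{qq}>0$, $\tilde C^P_{q\theta}\ge0$, $\tilde C^I_\theta>0$, $\tilde C^I_{qq}>0$, $\tilde C^I_{q\theta}\ge0$. For every $\theta\in[0,1]$: $V'(0)>\tilde C^P_q(0,\theta)$, and $V'(q)<\tilde C^P_q(q,\theta)+\tilde C^I_q(q,\theta)$ for all large $q$. Relaxed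 problem (P2): maximize $\mathbb E\sum_{i=1}^n\big(V(q_i(\theta_i))z_i(\bm\theta)-\tilde C^P(q_i(\theta_i),\theta_i)z_i(\bm\theta)-\tilde C^I(q_i(\theta_i),\theta_i)\big)$ over quality functions $q_i(\theta_i)\ge0$ (each depending on own type only) and allocation functions $z_i(\bm\theta)\ge0$ with $\sum_iz_i(\bm\theta)=1$. Symmetry constraint: the quality functions and the allocation functions are invariant under permutations of the firms' indices (in particular $q_i=q$ for all $i$). *)

(* Defs.v *)
From HB Require Import structures.
From mathcomp Require Import all_boot all_order all_algebra all_fingroup.
From mathcomp Require Import all_classical all_reals all_analysis.
Set Implicit Arguments.
Unset Strict Implicit.
Unset Printing Implicit Defensive.
Import Order.TTheory GRing.Theory Num.Theory.
Import numFieldNormedType.Exports.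
Local Open Scope classical_set_scope.
Local Open Scope ring_scope.

Section calculus.
Context {R : realType}.

Definition qualities : set R := `[0, +oo[.
Definition types : set R := `[0, 1].

(* Qualities and types range over sets with boundary.  Derivatives are limits
   of difference quotients along the points of the domain: they agree with
   g^`() in the interior, are one-sided at the boundary, and never look at the
   (meaningless) values of a function outside its domain. *)
Definition derivable_in (D : set R) (g : R -> R) (x : R) : Prop :=
  cvg ((g y - g x) / (y - x) @[y --> within D x^']).

Definition derive_in (D : set R) (g : R -> R) (x : R) : R :=
  lim ((g y - g x) / (y - x) @[y --> within D x^']).

(* k times continuously differentiable on D, up to the boundary *)
Fixpoint smooth_in (D : set R) (k : nat) (g : R -> R) : Prop :=
  {within D, continuous g} /\
  (if k is k'.+1 then
     (forall x, D x -> derivable_in D g x) /\ smooth_in D k' (derive_in D g)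
   else True).

(* Costs take the quality first and the type second.  C_{q theta} is
   [partial_t (partial_q C)]. *)
Definition partial_q (C : R -> R -> R) (q t : R) : R :=
  derive_in qualities (C ^~ t) q.

Definition partial_t (C : R -> R -> R) (q t : R) : R :=
  derive_in types (C q) t.

(* All iterated partial derivatives of order at most k exist and are jointly
   continuous on qualities `*` types, up to the boundary. *)
Fixpoint smooth_cost (k : nat) (C : R -> R -> R) : Prop :=
  {within qualities `*` types, continuous (fun p : R * R => C p.1 p.2)} /\
  (if k is k'.+1 then
     [/\ forall q t, qualities q -> types t ->
           derivable_in qualities (C ^~ t) q /\ derivable_in types (C q) t,
         smooth_cost k' (partial_q C) & smooth_cost k' (partial_t C)]
   else True).

Definition virtual_cost (F f : R -> R) (C : R -> R -> R) (q t : R) : R :=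
  C q t + partial_t C q t * (F t / f t).

End calculus.

Section procurement.
Context {R : realType} {d : measure_display} {T : measurableType d}.
Context (P : probability T R) {n : nat}.
Implicit Types (theta : 'I_n -> {RV P >-> R}).
Implicit Types (q : 'I_n -> R -> R) (z : 'I_n -> n.-tuple R -> R).

Definition mutually_independent theta : Prop :=
  forall (J : {set 'I_n}) (A : 'I_n -> set R),
    (forall j, measurable (A j)) ->
    P (\bigcap_(j in [set` J]) (theta j @^-1` A j)) =
    (\prod_(j in J) P (theta j @^-1` A j))%E.

Definition profiles : set (n.-tuple R) :=
  [set t | forall i, types (tnth t i)].

Definition profile theta (w : T) : n.-tuple R := [tuple theta i w | i < n].

(* The allocation must add up to one almost surely only: when several firms
   tie for the lowest type, the indicators of theta_i = theta_(1) add up to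
   more than one. *)
Definition feasible theta q z : Prop :=
  [/\ forall i, measurable_fun types (q i),
      forall i s, types s -> 0 <= q i s,
      forall i, measurable_fun profiles (z i),
      forall i t, profiles t -> 0 <= z i t &
      {ae P, forall w, \sum_(i < n) z i (profile theta w) = 1}].

(* In the profile [tuple tnth t (s j) | j < n], firm i has the type that firm
   s i has in t. *)
Definition permutation_invariant q z : Prop :=
  forall s : 'S_n,
    (forall i x, types x -> q (s i) x = q i x) /\
    (forall i t, profiles t ->
       z (s i) t = z i [tuple tnth t (s j) | j < n]).

(* The expectation is extended-real valued, so no integrability requirement is
   put on (q, z). *)
Definition objective (V : R -> R) (vCP vCI : R -> R -> R) theta q z : \bar R :=
  ('E_P[(fun w => \sum_(i < n)
     (V (q i (theta i w)) * z i (profile theta w)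
      - vCP (q i (theta i w)) (theta i w) * z i (profile theta w)
      - vCI (q i (theta i w)) (theta i w)))%R])%E.

Definition solves_symmetric_P2 V vCP vCI theta q z : Prop :=
  [/\ feasible theta q z, permutation_invariant q z &
      forall q' z', feasible theta q' z' -> permutation_invariant q' z' ->
        (objective V vCP vCI theta q' z' <= objective V vCP vCI theta q z)%E].

End procurement.

(* For n > 0 and types in [0, 1] the default value 1 plays no role. *)
Definition lowest_type {R : realType} {n : nat} (t : n.-tuple R) : R :=
  \big[Num.min/1]_(j < n) tnth t j.

Definition z_sym {R : realType} {n : nat} (i : 'I_n) (t : n.-tuple R) : R :=
  (tnth t i == lowest_type t)%:R.

(* The type 1 is left out: there 1 - F vanishes. *)
Definition first_order_condition {R : realType} (n : nat) (F V : R -> R)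
    (vCP vCI : R -> R -> R) (q : R -> R) : Prop :=
  forall t, t \in `[0, 1[ ->
    derive_in qualities V (q t) =
    partial_q vCP (q t) t + partial_q vCI (q t) t / (1 - F t) ^+ n.-1.

(* Main.v *)
Require Import Defs.
From HB Require Import structures.
From mathcomp Require Import all_boot all_order all_algebra all_fingroup.
From mathcomp Require Import all_classical all_reals all_analysis.
From mathcomp Require Import measurable_realfun.
From mathcomp Require Import ring lra.
Import Order.TTheory GRing.Theory Num.Theory.
Import numFieldNormedType.Exports.
Local Open Scope classical_set_scope.
Local Open Scope ring_scope.
Local Set Implicit Arguments.
Local Unset Strict Implicit.
Local Unset Printing Implicit Defensive.

(* A relaxed allocation is bounded by a Legendre-type inequality.  Write W(q,t) =
   V(q) - vCP(q,t), s(t) = W(q_sym(t),t) for the score of type t and K for the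
   distribution function of s(theta_i); s is decreasing, so a score r wins with
   probability K(r)^(n-1).  Let A be the primitive of K^(n-1).  The first order
   condition and the monotonicity of the marginal costs give, for every q and t,
     A(W(q,t)) - vCI(q,t) <= A(s(t)) - vCI(q_sym(t),t),
   so the surplus of a symmetric (q,z) is at most, up to a term not depending on
   (q,z),
     E[max_i x_i - sum_i A(x_i)],   x_i = W(q(theta_i),theta_i).
   The x_i are i.i.d.; if H is their distribution function, the layer cake formula
   turns this expectation into a constant minus the integral of
   H^n + n K^(n-1) (1 - H), which by convexity of x^n is smallest at H = K.  All
   inequalities are equalities for q_sym with the lowest type winning. *)

(** * One-sided derivatives *)

Section derivatives_in.
Context {R : realType}.
Implicit Types (D : set R) (g : R -> R).

(** For given qualities the best allocation picks the highest score, so the value of one type's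
    quality depends on the qualities of all other types, and the problem cannot be maximized type by
    type. The function A acts as a price that decouples the types: its slope at a score is the
    winning probability of that score, so the first order condition says that [q_sym] is critical
    for A(W(q,t)) - vCI(q,t) at each t.

    The symmetry constraint enters through the single distribution function H. With different H_i
    the integrand would be the product of the H_i plus K^(n-1) times the sum of the 1 - H_i; for n =
    2 its value at H_1 = 1, H_2 = 0 is K, below its value 2K - K^2 at H_1 = H_2 = K.

    Two obstacles shape the details. A competing quality may produce any score, so scores are
    truncated to an interval [m, M], with m below every W(0,t) and M above the scores of the
    solution; A vanishes below m and has slope 1 above M, which makes the truncation harmless. The
    solution is known only through its first order condition on [0, 1[, so K is built from a
    generalized inverse of the strictly decreasing score, and the types 0 and 1 and ties are removed
    as a null event. *)

Lemma within_continuousP {S U : topologicalType} (A : set S) (g : S -> U) :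
  {within A, continuous g} <->
  forall x, A x -> g y @[y --> within A (nbhs x)] --> g x.
Proof.
have nE x : A x -> nbhs (x : subspace A) = within A (nbhs x).
  by move=> Ax; rewrite (nbhs_subspace_in Ax).
rewrite continuous_subspace_in; split=> h x.
  by move=> Ax; rewrite -(nE x Ax); apply: h; rewrite inE.
by rewrite inE => Ax A' A'x; have := h x Ax A' A'x; rewrite -(nE x Ax).
Qed.

Lemma within_dnbhs_interior D x : (D°) x -> within D x^' = x^'.
Proof.
move=> Dx; apply/seteqP; split=> A; rewrite /within /dnbhs /within /=.
- by move=> h; apply: filterS2 Dx h => y Dy + yx; exact.
- by apply: filterS => y h + _; exact: h.
Qed.

Lemma cvg_shift_dnbhs g (x l : R) :
  g y @[y --> x^'] --> l -> g (h + x) @[h --> (0 : R)^'] --> l.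
Proof.
move=> gl; apply: (cvg_comp (fun h => h + x) g _ gl).
move=> A /= [e /= e0 eA]; exists e => //= h /=; rewrite sub0r normrN => he h0.
apply: eA; first by rewrite /= opprD addrCA subrr addr0 normrN.
by apply: contra_neq h0 => /(canRL (addrK _)); rewrite subrr.
Qed.

Lemma is_derive_in D g (x : R) : (D°) x -> derivable_in D g x ->
  is_derive x 1 g (derive_in D g x).
Proof.
move=> Dx; rewrite /derivable_in /derive_in (within_dnbhs_interior Dx).
set l := lim _ => /cvg_shift_dnbhs; rewrite -/l => gl.
have {}gl : h^-1 *: ((g \o shift x) (h *: (1 : R)) - g x) @[h --> (0 : R)^'] --> l.
  apply: cvg_trans gl; apply: near_eq_cvg; near=> h.
  by rewrite /= addrK /GRing.scale /= mulr1 mulrC.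
split; first by apply/cvg_ex; exists l.
exact/cvg_lim.
Unshelve. all: by end_near. Qed.

Lemma is_derive_derivable_in D g (x l : R) : (D°) x -> is_derive x 1 g l ->
  derivable_in D g x /\ derive_in D g x = l.
Proof.
move=> Dx [dg gl]; rewrite /derivable_in /derive_in (within_dnbhs_interior Dx).
suff h : (g y - g x) / (y - x) @[y --> x^'] --> l.
  by split; [apply/cvg_ex; exists l | exact/cvg_lim].
have {}dg : h^-1 *: ((g \o shift x) (h *: (1 : R)) - g x) @[h --> (0 : R)^'] --> l.
  by rewrite -gl; exact: dg.
have : ((y - x)^-1 *: ((g \o shift x) ((y - x) *: (1 : R)) - g x)) @[y --> x^'] --> l.
  apply: (cvg_comp _ _ _ dg).
  move=> A /= [e /= e0 eA]; exists e => //= h /= he hx.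
  by apply: eA => /=; rewrite ?sub0r ?normrN ?subr_eq0// distrC.
apply: cvg_trans; apply: near_eq_cvg; near=> y.
by rewrite /= /GRing.scale /= mulr1 subrK mulrC.
Unshelve. all: by end_near. Qed.

Lemma derive_in_eq D g1 g2 (x : R) : D x -> (forall y, D y -> g1 y = g2 y) ->
  (derivable_in D g1 x <-> derivable_in D g2 x) /\
  derive_in D g1 x = derive_in D g2 x.
Proof.
move=> Dx g12.
suff e : ((g1 y - g1 x) / (y - x)) @[y --> within D x^'] =
         ((g2 y - g2 x) / (y - x)) @[y --> within D x^'].
  by rewrite /derivable_in /derive_in e.
by apply/seteqP; split; apply: near_eq_cvg; rewrite near_withinE; apply: nearW => y Dy;
  rewrite /= (g12 _ Dx) (g12 _ Dy).
Qed.

Lemma derivable_in_continuous D g (x : R) : derivable_in D g x ->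
  g y @[y --> within D (nbhs x)] --> g x.
Proof.
rewrite /derivable_in; set l := lim _ => gl.
suff : g y @[y --> within D x^'] --> g x.
  move=> h A Ax; have := h A Ax; apply: (@filterS _ (nbhs x) _) => y h' Dy.
  by have [->|yx] := eqVneq y x; [exact: (nbhs_singleton Ax)|exact: (h' yx Dy)].
have yx0 : (y - x : R) @[y --> within D x^'] --> (0 : R).
  rewrite -(subrr x); apply: cvgB; last exact: cvg_cst.
  by move=> A; apply: (@filterS _ (nbhs x) _) => y Ay _ _.
have : (g y - g x) / (y - x) * (y - x) + g x @[y --> within D x^'] --> l * 0 + g x.
  by apply: cvgD; [exact: cvgM|exact: cvg_cst].
rewrite mulr0 add0r; apply: cvg_trans; apply: near_eq_cvg.
apply: (@filterS _ (nbhs x) _ setT) => [y _ yx _|]; last exact: filterT.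
by rewrite -mulrA mulVf ?mulr1 ?subrK// subr_eq0.
Qed.

Lemma derive_inDZ D g1 g2 (c x : R) : ProperFilter (within D x^') ->
  derivable_in D g1 x -> derivable_in D g2 x ->
  derivable_in D (fun y => g1 y + g2 y * c) x /\
  derive_in D (fun y => g1 y + g2 y * c) x = derive_in D g1 x + derive_in D g2 x * c.
Proof.
move=> PF d1 d2.
suff h : (g1 y + g2 y * c - (g1 x + g2 x * c)) / (y - x) @[y --> within D x^'] -->
    derive_in D g1 x + derive_in D g2 x * c.
  by split; [apply/cvg_ex; eexists; exact: h | exact/cvg_lim].
have : (g1 y - g1 x) / (y - x) + (g2 y - g2 x) / (y - x) * c @[y --> within D x^'] -->
    derive_in D g1 x + derive_in D g2 x * c.
  by apply: cvgD; [exact: d1|apply: cvgM; [exact: d2|exact: cvg_cst]].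
apply: cvg_trans; apply: near_eq_cvg; apply: nearW => y.
by ring.
Qed.

Lemma qualities_within_dnbhs (x : R) : qualities x -> ProperFilter (within qualities x^').
Proof.
rewrite /qualities /= in_itv /= andbT => x0; apply: Build_ProperFilter_ex => A.
move=> [e /= e0 h]; exists (x + e / 2); apply: h.
- by rewrite /= opprD addrA subrr sub0r normrN gtr0_norm ?divr_gt0// ltr_pdivrMr// ltr_pMr// ltr1n.
- by rewrite gt_eqF// ltrDl divr_gt0.
- by rewrite /= in_itv /= andbT; apply: addr_ge0 => //; apply: divr_ge0 => //; exact: ltW.
Qed.

Lemma itv_oo_interior D (a b x : R) : `[a, b] `<=` D -> a < x < b -> (D°) x.
Proof.
move=> abD /andP[ax xb]; rewrite /interior /=; near=> y; apply: abD => /=.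
rewrite in_itv /=; apply/andP; split; apply: ltW; near: y.
- exact: lt_nbhsr.
- exact: lt_nbhsl.
Unshelve. all: by end_near. Qed.

Lemma is_derive_incr g (dg : R -> R) (a b : R) : a < b ->
  {within `[a, b], continuous g} ->
  (forall x, a < x < b -> is_derive x 1 g (dg x) /\ 0 < dg x) -> g a < g b.
Proof.
move=> ab cg gd.
have [|c] := @MVT _ g dg a b ab _ cg.
  by move=> x; rewrite in_itv /= => /gd[].
by rewrite in_itv /= => /gd[_ c0] e; rewrite -subr_gt0 e mulr_gt0// subr_gt0.
Qed.

Lemma is_derive_ndecr g (dg : R -> R) (a b : R) : a <= b ->
  {within `[a, b], continuous g} ->
  (forall x, a < x < b -> is_derive x 1 g (dg x) /\ 0 <= dg x) -> g a <= g b.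
Proof.
rewrite le_eqVlt => /predU1P[->//|ab] cg gd.
have [|c] := @MVT _ g dg a b ab _ cg.
  by move=> x; rewrite in_itv /= => /gd[].
by rewrite in_itv /= => /gd[_ c0] e; rewrite -subr_ge0 e mulr_ge0// subr_ge0 ltW.
Qed.

Lemma derive_in_incr D g (a b : R) : a < b -> `[a, b] `<=` D ->
  {within `[a, b], continuous g} ->
  (forall x, a < x < b -> derivable_in D g x /\ 0 < derive_in D g x) ->
  g a < g b.
Proof.
move=> ab abD cg gd; apply: (@is_derive_incr g (derive_in D g)) => // x xab.
have [dx d0] := gd x xab; split; last exact: d0.
exact: is_derive_in (itv_oo_interior abD xab) dx.
Qed.

Lemma derive_in_ndecr D g (a b : R) : a <= b -> `[a, b] `<=` D ->
  {within `[a, b], continuous g} ->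
  (forall x, a < x < b -> derivable_in D g x /\ 0 <= derive_in D g x) ->
  g a <= g b.
Proof.
move=> ab abD cg gd; apply: (@is_derive_ndecr g (derive_in D g)) => // x xab.
have [dx d0] := gd x xab; split; last exact: d0.
exact: is_derive_in (itv_oo_interior abD xab) dx.
Qed.

End derivatives_in.

(** * Virtual costs and the type distribution *)

Section virtual_cost_calculus.
Context {R : realType}.
Implicit Types (q t x y e : R) (C : R -> R -> R).

Lemma in_qualities q : qualities q <-> 0 <= q.
Proof. by rewrite /qualities /= in_itv /= andbT. Qed.

Lemma in_types t : types t <-> 0 <= t <= 1.
Proof. by rewrite /types /= in_itv. Qed.

Lemma interior_types t : 0 < t < 1 -> types t.
Proof. by move=> /andP[t0 t1]; apply/in_types; rewrite !ltW. Qed.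

Lemma qualities_interior q : 0 < q -> (qualities°) q.
Proof.
move=> q0; apply: (@itv_oo_interior _ _ 0 (q + 1)); last by rewrite q0 ltrDl ltr01.
by move=> x; rewrite /= in_itv /= => /andP[x0 _]; exact/in_qualities.
Qed.

Lemma types_interior t : 0 < t < 1 -> (types°) t.
Proof. by apply: itv_oo_interior. Qed.

Lemma sub_qualities (a b : R) : 0 <= a -> `[a, b] `<=` qualities.
Proof. by move=> a0 x; rewrite /= in_itv /= => /andP[/(le_trans a0) ? _]; exact/in_qualities. Qed.

Lemma sub_types (a b : R) : 0 <= a -> b <= 1 -> `[a, b] `<=` types.
Proof.
move=> a0 b1 x; rewrite /= in_itv /= => /andP[/(le_trans a0) ? xb]; apply/in_types.
by apply/andP; split => //; exact: le_trans xb b1.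
Qed.

Lemma derivable_in_within D (g : R -> R) :
  (forall x, D x -> derivable_in D g x) -> {within D, continuous g}.
Proof. by move=> dg; apply/within_continuousP => x /dg; exact: derivable_in_continuous. Qed.

Lemma within_prod_dist (D1 D2 : set R) (g : R -> R -> R) q t e :
  {within D1 `*` D2, continuous (fun p : R * R => g p.1 p.2)} ->
  D1 q -> D2 t -> 0 < e ->
  exists2 d : R, 0 < d & forall x y, D1 x -> D2 y ->
    `|q - x| < d -> `|t - y| < d -> `|g q t - g x y| < e.
Proof.
move=> /within_continuousP/(_ (q, t)) cg Dq Dt e0.
have /cg/cvgrPdist_lt/(_ _ e0) : (D1 `*` D2) (q, t) by [].
rewrite near_withinE => /nbhs_ballP[d /= d0 h]; exists d => // x y Dx Dy qx ty.
exact: (h (x, y)).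
Qed.

Lemma smooth_cost_cont k C : smooth_cost k C ->
  {within qualities `*` types, continuous (fun p : R * R => C p.1 p.2)}.
Proof. by case: k => [|k] []. Qed.

Lemma smooth_costS k C : smooth_cost k.+1 C ->
  [/\ forall q t, qualities q -> types t ->
        derivable_in qualities (C ^~ t) q /\ derivable_in types (C q) t,
      smooth_cost k (partial_q C) & smooth_cost k (partial_t C)].
Proof. by case. Qed.

Lemma smooth_cost_t_cont k C q : smooth_cost k C -> qualities q -> {within types, continuous (C q)}.
Proof.
move=> sC Qq; apply/within_continuousP => t Tt; apply/cvgrPdist_lt => e e0.
have [d d0 h] := within_prod_dist (smooth_cost_cont sC) Qq Tt e0.
rewrite near_withinE; apply/nbhs_ballP; exists d => //= y ty Ty.
by apply: h => //; rewrite subrr normr0.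
Qed.

(** * Mixed partial derivatives at quality 0 *)

Section mixed_partial.
Context (C : R -> R -> R).
Hypothesis C_smooth : smooth_cost 3 C.
Hypothesis C_t : forall q t, 0 < q -> 0 < t < 1 -> 0 < partial_t C q t.
Hypothesis C_0 : forall t, 0 < t < 1 -> C 0 t = 0.
Hypothesis Cq_0 : forall t, 0 < t < 1 -> partial_q C 0 t = 0.

Let Q0 : qualities (0 : R). Proof. exact/in_qualities. Qed.

Lemma partial_t_at0 t : 0 < t < 1 -> partial_t C 0 t = 0.
Proof.
move=> /andP[t0 t1].
suff h : is_derive t 1 (C 0) 0.
  by have [] := is_derive_derivable_in (types_interior _) h; rewrite ?t0.
apply: (near_eq_is_derive _ (is_derive_cst (0 : R) t (1 : R))).
near=> s; rewrite /= C_0//; apply/andP; split; near: s.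
- exact: lt_nbhsr.
- exact: lt_nbhsl.
Unshelve. all: by end_near. Qed.

(** Type 0 is not covered by [Cq_0]; it is reached as a limit of interior types, [partial_q C 0]
    being continuous in the type. *)
Lemma partial_q_at00 : partial_q C 0 0 = 0.
Proof.
have [_ sq _] := smooth_costS C_smooth; have cq := smooth_cost_t_cont sq Q0.
have T0 : types (0 : R) by apply/in_types; rewrite lexx ler01.
have /within_continuousP/(_ 0 T0) h := cq.
apply/eqP; rewrite -normr_le0; apply/ler_addgt0Pr => e e0; rewrite add0r.
move/cvgrPdist_lt/(_ _ e0) : h; rewrite near_withinE => /nbhs_ballP[d /= d0 h].
pose x := Num.min (d / 2) (1/2).
have x0 : 0 < x by rewrite lt_min; apply/andP; split; lra.
have xd : x <= d / 2 by rewrite ge_min lexx.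
have x1 : x <= 1 / 2 by rewrite ge_min lexx orbT.
have x01 : 0 < x < 1 by rewrite x0 /=; lra.
have := h x; rewrite /= (Cq_0 x01) subr0 => hx.
apply/ltW/hx; last exact: interior_types.
rewrite /ball /= sub0r normrN gtr0_norm//; lra.
Qed.

(* The mixed partials commute at the boundary: by the mean value theorem a
   nonzero [partial_q (partial_t C) 0 t] would make [partial_q C 0] vary. *)
Lemma partial_qt_at0 t : 0 < t < 1 -> partial_q (partial_t C) 0 t = 0.
Proof.
move=> t01; have Tt := interior_types t01.
have [dC sq st] := smooth_costS C_smooth; have [dt stq stt] := smooth_costS st.
have [dCq _] := dC 0 t Q0 Tt; have [dCtq _] := dt 0 t Q0 Tt.
have PF := qualities_within_dnbhs Q0.
(* The limit is nonnegative, because [partial_t C] vanishes at quality 0 and is positive beyond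
   it. *)
apply/eqP; rewrite eq_le; apply/andP; split; last first.
  apply: limr_ge; first exact: dCtq.
  exists 1 => //= x _ x0 Qx.
  rewrite /= partial_t_at0// !subr0 divr_ge0//; last exact/in_qualities.
  apply/ltW/C_t => //; rewrite lt_neqAle eq_sym x0; exact/in_qualities.
rewrite leNgt; apply/negP; set D := partial_q _ 0 t => D0.
have D20 : 0 < D / 2 by rewrite divr_gt0.
have [d d0 dD] := within_prod_dist (smooth_cost_cont stq) Q0 Tt D20.
have [t0 t1] := andP t01.
pose u := t + Num.min (d / 2) ((1 - t) / 2).
have tu : t < u by rewrite ltrDl lt_min !divr_gt0// subr_gt0.
have u1 : u < 1.
  have : Num.min (d / 2) ((1 - t) / 2) <= (1 - t) / 2 by rewrite ge_min lexx orbT.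
  rewrite /u; lra.
have ud : u - t < d.
  have : Num.min (d / 2) ((1 - t) / 2) <= d / 2 by rewrite ge_min lexx.
  rewrite /u; lra.
have u01 : 0 < u < 1 by rewrite u1 (lt_trans t0).
(* Near [(0, t)] the derivative [partial_q (partial_t C)] exceeds [D / 2]; this bound is integrated
   in the quality, starting from [partial_t C 0 s = 0]. *)
have step1 q s : 0 < q -> q < d -> t <= s <= u -> D / 2 * q <= partial_t C q s.
  move=> q0 qd /andP[ts su].
  have s01 : 0 < s < 1 by rewrite (lt_le_trans t0)// (le_lt_trans su).
  have Ts := interior_types s01.
  have := @is_derive_ndecr _ (fun x => partial_t C x s - D / 2 * x)
    (fun x => partial_q (partial_t C) x s - D / 2) 0 q (ltW q0).
  rewrite mulr0 subr0 partial_t_at0// subr_ge0; apply.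
    apply/within_continuousP => x xq; apply: cvgB.
      have cs : {within qualities, continuous (fun x => partial_t C x s)}.
        by apply: derivable_in_within => y Qy; case: (dt y s Qy Ts).
      exact: ((within_continuousP _ _).1 (continuous_subspaceW (@sub_qualities 0 q (lexx 0)) cs)).
    by apply: cvgM; [exact: cvg_cst|apply: cvg_within].
  move=> x /andP[x0 xq]; have Qx : qualities x by apply/in_qualities/ltW.
  split.
    apply: is_deriveB.
      by apply: is_derive_in; [exact: qualities_interior|case: (dt x s Qx Ts)].
    by rewrite -[X in is_derive _ _ _ X]mulr1; exact: is_deriveZ.
  have := dD x s Qx Ts; rewrite sub0r normrN gtr0_norm// => /(_ (lt_trans xq qd)).
  rewrite distrC ger0_norm ?subr_ge0// => /(_ (le_lt_trans (lerB su (lexx t)) ud)).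
  by rewrite -/D ltr_distlC => /andP[+ _]; lra.
(* A second integration, now in the type from [t] to [u]. As [q] tends to 0 the right side tends to
   [partial_q C 0 u - partial_q C 0 t], which is 0. *)
have step2 q : 0 < q -> q < d -> D / 2 * (u - t) <= (C q u - C q t) / q.
  move=> q0 qd; rewrite ler_pdivlMr// mulrAC.
  have Qq : qualities q by apply/in_qualities/ltW.
  have : C q t - D / 2 * q * t <= C q u - D / 2 * q * u.
    apply: (@is_derive_ndecr _ (fun s => C q s - D / 2 * q * s)
      (fun s => partial_t C q s - D / 2 * q)) => //; first exact: ltW.
      apply/within_continuousP => x xq; apply: cvgB.
        have /within_continuousP := continuous_subspaceW
          (@sub_types t u (ltW t0) (ltW u1)) (smooth_cost_t_cont C_smooth Qq).
        exact.
      by apply: cvgM; [exact: cvg_cst|apply: cvg_within].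
    move=> s /andP[ts su].
    have s01 : 0 < s < 1 by rewrite (lt_trans t0)// (lt_trans su).
    split; last by rewrite subr_ge0; apply: step1; rewrite ?ltW.
    apply: is_deriveB.
      by apply: is_derive_in; [exact: types_interior|case: (dC q s Qq (interior_types s01))].
    by rewrite -[X in is_derive _ _ _ X]mulr1; exact: is_deriveZ.
  by rewrite mulrBr; lra.
have [dCu _] := dC 0 u Q0 (interior_types u01).
suff : D / 2 * (u - t) <= 0 by rewrite leNgt mulr_gt0// subr_gt0.
have lim0 : (C y u - C 0 u) / (y - 0) - (C y t - C 0 t) / (y - 0)
    @[y --> within qualities (0 : R)^'] --> partial_q C 0 u - partial_q C 0 t.
  by apply: cvgB; [exact: dCu|exact: dCq].
rewrite (Cq_0 u01) (Cq_0 t01) subrr in lim0.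
apply: (@ler_cvg_to _ _ PF _ (cst (D / 2 * (u - t))) _ _ _ _ lim0); first exact: cvg_cst.
exists d => // x.
rewrite /= sub0r normrN => xd x0 /in_qualities Qx.
have {}x0 : 0 < x by rewrite lt_neqAle eq_sym x0.
rewrite !C_0// !subr0 -mulrBl; apply: step2 => //.
by rewrite -(gtr0_norm x0).
Qed.

End mixed_partial.
End virtual_cost_calculus.

(** * Monotonicity of virtual costs and of their marginals *)

Section virtual_cost_monotonicity.
Context {R : realType} (F f : R -> R) (C : R -> R -> R).
Implicit Types (q t x y s : R).
Let r t : R := F t / f t.
Hypothesis r_cont : {within types, continuous r}.
Hypothesis r_der : forall t, 0 < t < 1 -> derivable r t 1.
Hypothesis C_smooth : smooth_cost 3 C.

Local Notation vC := (virtual_cost F f C).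
Local Notation vCq := (partial_q (virtual_cost F f C)).

Let C1 := smooth_costS C_smooth.
Let Cq_smooth : smooth_cost 2 (partial_q C). Proof. by have [] := C1. Qed.
Let Ct_smooth : smooth_cost 2 (partial_t C). Proof. by have [] := C1. Qed.
Let Ctq_smooth : smooth_cost 1 (partial_q (partial_t C)).
Proof. by have [] := smooth_costS Ct_smooth. Qed.

Lemma virtual_cost_partial_q q t : qualities q -> types t ->
  derivable_in qualities (vC ^~ t) q /\
  vCq q t = partial_q C q t + partial_q (partial_t C) q t * r t.
Proof.
move=> Qq Tt; have PF := qualities_within_dnbhs Qq.
have [/(_ _ _ Qq Tt)[d1 _] _ _] := C1.
have [/(_ _ _ Qq Tt)[d2 _] _ _] := smooth_costS Ct_smooth.
exact: derive_inDZ.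
Qed.

Lemma virtual_cost_derivable_qq q t : qualities q -> types t ->
  derivable_in qualities (vCq ^~ t) q.
Proof.
move=> Qq Tt; have PF := qualities_within_dnbhs Qq.
have [/(_ _ _ Qq Tt)[d1 _] _ _] := smooth_costS Cq_smooth.
have [/(_ _ _ Qq Tt)[d2 _] _ _] := smooth_costS Ctq_smooth.
have [e _] := @derive_in_eq _ _ (vCq ^~ t)
  (fun q => partial_q C q t + partial_q (partial_t C) q t * r t) q Qq
  (fun y Qy => (virtual_cost_partial_q Qy Tt).2).
by apply/e; have [] := derive_inDZ (r t) PF d1 d2.
Qed.

Let derivable_in_typesDM (g1 g2 : R -> R) t : 0 < t < 1 ->
  derivable_in types g1 t -> derivable_in types g2 t ->
  derivable_in types (fun s => g1 s + g2 s * r s) t.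
Proof.
move=> t01 /(is_derive_in (types_interior t01)) d1 /(is_derive_in (types_interior t01)) d2.
have d3 : is_derive t 1 r ('D_1 r t) by split => //; exact: r_der.
have d4 : is_derive t 1 (fun s => g1 s + g2 s * r s) _ := is_deriveD d1 (is_deriveM d2 d3).
by have [] := is_derive_derivable_in (types_interior t01) d4.
Qed.

Lemma virtual_cost_derivable_t q t : qualities q -> 0 < t < 1 ->
  derivable_in types (vC q) t.
Proof.
move=> Qq t01; have Tt := interior_types t01.
have [/(_ _ _ Qq Tt)[_ d1] _ _] := C1.
have [/(_ _ _ Qq Tt)[_ d2] _ _] := smooth_costS Ct_smooth.
exact: derivable_in_typesDM.
Qed.

Lemma virtual_cost_derivable_qt q t : qualities q -> 0 < t < 1 ->
  derivable_in types (vCq q) t.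
Proof.
move=> Qq t01; have Tt := interior_types t01.
have [/(_ _ _ Qq Tt)[_ d1] _ _] := smooth_costS Cq_smooth.
have [/(_ _ _ Qq Tt)[_ d2] _ _] := smooth_costS Ctq_smooth.
have [e _] := @derive_in_eq _ _ (vCq q)
  (fun t => partial_q C q t + partial_q (partial_t C) q t * r t) t Tt
  (fun y Ty => (virtual_cost_partial_q Qq Ty).2).
by apply/e; exact: derivable_in_typesDM.
Qed.

Let within_typesDM (g1 g2 : R -> R) :
  {within types, continuous g1} -> {within types, continuous g2} ->
  {within types, continuous (fun s => g1 s + g2 s * r s)}.
Proof.
move=> /within_continuousP c1 /within_continuousP c2; apply/within_continuousP => t Tt.
have /within_continuousP c3 := r_cont.
by apply: cvgD; [exact: c1|apply: cvgM; [exact: c2|exact: c3]].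
Qed.

Lemma virtual_cost_cont_t q : qualities q -> {within types, continuous (vC q)}.
Proof.
move=> Qq; apply: within_typesDM.
- exact: smooth_cost_t_cont C_smooth Qq.
- exact: smooth_cost_t_cont Ct_smooth Qq.
Qed.

Lemma virtual_cost_q_cont_t q : qualities q -> {within types, continuous (vCq q)}.
Proof.
move=> Qq; have /within_continuousP h := within_typesDM
  (smooth_cost_t_cont Cq_smooth Qq) (smooth_cost_t_cont Ctq_smooth Qq).
apply/within_continuousP => t Tt.
rewrite (virtual_cost_partial_q Qq Tt).2; apply: cvg_trans (h t Tt).
apply: near_eq_cvg; rewrite near_withinE; apply: nearW => s Ts.
by rewrite (virtual_cost_partial_q Qq Ts).2.
Qed.

Lemma virtual_cost_cont_q t : types t -> {within qualities, continuous (vC ^~ t)}.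
Proof.
by move=> Tt; apply: derivable_in_within => q Qq; have [] := virtual_cost_partial_q Qq Tt.
Qed.

Lemma virtual_cost_q_cont_q t : types t -> {within qualities, continuous (vCq ^~ t)}.
Proof.
by move=> Tt; apply: derivable_in_within => q Qq; exact: virtual_cost_derivable_qq.
Qed.

Lemma virtual_cost_is_derive q t : 0 < q -> types t -> is_derive q 1 (vC ^~ t) (vCq q t).
Proof.
move=> q0 Tt; apply: is_derive_in; first exact: qualities_interior.
by have [] := @virtual_cost_partial_q q t _ Tt; first exact/in_qualities/ltW.
Qed.

Hypothesis vC_partials : forall q t, 0 < q -> t \in `]0, 1[ ->
  [/\ 0 < partial_t vC q t, 0 < partial_q vCq q t & 0 <= partial_t vCq q t].

Lemma virtual_cost_q_incr q q' t : 0 <= q -> q < q' -> 0 < t < 1 -> vCq q t < vCq q' t.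
Proof.
move=> q0 qq t01; have Tt := interior_types t01.
apply: (@derive_in_incr _ qualities (vCq ^~ t)) => //.
- exact: sub_qualities.
- by apply: continuous_subspaceW (virtual_cost_q_cont_q Tt); exact: sub_qualities.
- move=> x /andP[qx _]; have x0 := le_lt_trans q0 qx; split.
    by apply: virtual_cost_derivable_qq => //; exact/in_qualities/ltW.
  by have [] := @vC_partials x t x0; rewrite ?in_itv.
Qed.

(** The mean value theorem asks for the sign of the derivative strictly inside and for continuity
    alone at the ends, so types 0 and 1 are included although the partial derivatives are controlled
    only between them. *)
Lemma virtual_cost_t_incr q s t : 0 < q -> 0 <= s -> s < t -> t <= 1 -> vC q s < vC q t.
Proof.
move=> q0 s0 st t1; have Qq : qualities q by exact/in_qualities/ltW.
apply: (@derive_in_incr _ types (vC q)) => //.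
- exact: sub_types.
- by apply: continuous_subspaceW (virtual_cost_cont_t Qq); exact: sub_types.
- move=> x /andP[sx xt]; have x01 : 0 < x < 1 by rewrite (le_lt_trans s0)// (lt_le_trans xt).
  split; first exact: virtual_cost_derivable_t.
  by have [] := @vC_partials q x q0; rewrite ?in_itv.
Qed.

Lemma virtual_cost_q_t_ndecr q s t : 0 < q -> 0 <= s -> s <= t -> t <= 1 -> vCq q s <= vCq q t.
Proof.
move=> q0 s0 st t1; have Qq : qualities q by exact/in_qualities/ltW.
apply: (@derive_in_ndecr _ types (vCq q)) => //.
- exact: sub_types.
- by apply: continuous_subspaceW (virtual_cost_q_cont_t Qq); exact: sub_types.
- move=> x /andP[sx xt]; have x01 : 0 < x < 1 by rewrite (le_lt_trans s0)// (lt_le_trans xt).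
  split; first exact: virtual_cost_derivable_qt.
  by have [] := @vC_partials q x q0; rewrite ?in_itv.
Qed.

End virtual_cost_monotonicity.

(** * The distribution function as an integral of the density *)

Section distribution_function.
Context {R : realType} (F f : R -> R).
Implicit Types (s t x y : R).
Hypothesis F_density : forall x, types x ->
  (F x)%:E = (\int[lebesgue_measure]_(t in `[0%R, x]) (f t)%:E)%E.
Hypothesis f_gt0 : forall t, types t -> 0 < f t.
Hypothesis f_smooth : smooth_in types 1 f.

Let f_cont : {within types, continuous f}. Proof. by case: f_smooth. Qed.

Let f_integrable : lebesgue_measure.-integrable `[(0 : R), 1] (EFin \o f).
Proof. by apply: continuous_compact_integrable => //; exact: segment_compact. Qed.

Let F_Rintegral x : types x -> F x = \int[lebesgue_measure]_(t in `[0, x]) f t.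
Proof. by move=> Tx; rewrite /Rintegral -F_density. Qed.

Lemma cdf_within_cont : {within types, continuous F}.
Proof.
have /within_continuousP h := parameterized_integral_continuous (@ler01 R) f_integrable.
apply/within_continuousP => t Tt; rewrite (F_Rintegral Tt).
apply: cvg_trans (h t Tt); apply: near_eq_cvg; rewrite near_withinE; apply: nearW => s Ts.
by rewrite (F_Rintegral Ts).
Qed.

Lemma cdf_is_derive t : 0 < t < 1 -> is_derive t 1 F (f t).
Proof.
move=> t01; have [t0 t1] := andP t01.
have ft : {for t, continuous f}.
  have /within_continuousP/(_ t (interior_types t01)) := f_cont.
  by rewrite within_interior//; exact: types_interior.
have [dG G'] := continuous_FTC1_closed t1 f_integrable t0 ft.
apply: (near_eq_is_derive (f := fun x => \int[lebesgue_measure]_(t in `[0, x]) f t)).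
  near=> s; rewrite F_Rintegral//; apply: interior_types.
  by apply/andP; split; near: s; [exact: lt_nbhsr|exact: lt_nbhsl].
by split; [exact: dG|rewrite -derive1E].
Unshelve. all: by end_near. Qed.

Lemma cdf_incr s t : 0 <= s -> s < t -> t <= 1 -> F s < F t.
Proof.
move=> s0 st t1; apply: (@is_derive_incr _ F f) => //.
  by apply: continuous_subspaceW cdf_within_cont; exact: sub_types.
move=> x /andP[sx xt].
have x01 : 0 < x < 1 by rewrite (le_lt_trans s0)// (lt_le_trans xt).
by split; [exact: cdf_is_derive|exact/f_gt0/interior_types].
Qed.

(** The constant is the maximum of [f] on the compact type interval. The bound later shows that
    single types and ties have probability 0. *)
Lemma cdf_lipschitz : exists2 M : R, 0 < M &
  forall s t, 0 <= s -> s <= t -> t <= 1 -> F t - F s <= M * (t - s).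
Proof.
have [c c01 fc] := EVT_max ler01 f_cont.
exists (f c); first by apply: f_gt0; rewrite /types.
move=> s t s0 st t1; rewrite mulrBr lerBlDr addrAC -lerBlDr opprK.
suff : f c * s - F s <= f c * t - F t by lra.
apply: (@is_derive_ndecr _ (fun x => f c * x - F x) (fun x => f c - f x)) => //.
  apply/within_continuousP => x xst; apply: cvgB.
    by apply: cvgM; [exact: cvg_cst|exact: cvg_within].
  have /within_continuousP := continuous_subspaceW (sub_types s0 t1) cdf_within_cont.
  exact.
move=> x /andP[sx xt].
have x01 : 0 < x < 1 by rewrite (le_lt_trans s0)// (lt_le_trans xt).
split; last by rewrite subr_ge0; apply: fc; move: (interior_types x01).
apply: is_deriveB; last exact: cdf_is_derive.
by rewrite -[X in is_derive _ _ _ X]mulr1; exact: is_deriveZ.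
Qed.

Lemma cdf_at0 : F 0 = 0.
Proof.
rewrite F_Rintegral ?set_itv1 ?Rintegral_set1//; exact/in_types/andP.
Qed.

Lemma hazard_within_cont : {within types, continuous (fun t => F t / f t)}.
Proof.
have /within_continuousP Fc := cdf_within_cont.
have /within_continuousP fc := f_cont.
apply/within_continuousP => t Tt; apply: cvgM; first exact: Fc.
by apply: cvgV; [rewrite gt_eqF// f_gt0|exact: fc].
Qed.

Lemma hazard_derivable t : 0 < t < 1 -> derivable (fun t => F t / f t) t 1.
Proof.
move=> t01; have Tt := interior_types t01; have [dF _] := cdf_is_derive t01.
have [_ [/(_ t Tt) df _]] := f_smooth.
have [{}df _] := is_derive_in (types_interior t01) df.
apply: (derivableM dF); apply: (derivableV _ df).
by rewrite gt_eqF// f_gt0.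
Qed.

End distribution_function.

(** * Pointwise optimality of the first order condition *)

Section virtual_surplus.
Context {R : realType} (W c dW dc : R -> R -> R) (Z qs : R -> R).
Implicit Types q r s t x y e : R.
Hypothesis W_cont : forall t, 0 < t < 1 -> {within qualities, continuous (W ^~ t)}.
Hypothesis c_cont : forall t, 0 < t < 1 -> {within qualities, continuous (c ^~ t)}.
Hypothesis W_der : forall q t, 0 < q -> 0 < t < 1 -> is_derive q 1 (W ^~ t) (dW q t).
Hypothesis c_der : forall q t, 0 < q -> 0 < t < 1 -> is_derive q 1 (c ^~ t) (dc q t).
Hypothesis dW_q : forall q q' t, 0 <= q -> q <= q' -> 0 < t < 1 -> dW q' t <= dW q t.
Hypothesis dW_t : forall q s t, 0 < q -> 0 < s -> s <= t -> t < 1 -> dW q t <= dW q s.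
Hypothesis dc_q : forall q q' t, 0 <= q -> q < q' -> 0 < t < 1 -> dc q t < dc q' t.
Hypothesis dc_t : forall q s t, 0 < q -> 0 < s -> s <= t -> t < 1 -> dc q s <= dc q t.
Hypothesis dc_0 : forall t, 0 < t < 1 -> dc 0 t = 0.
Hypothesis W_t : forall q s t, 0 < q -> 0 < s -> s < t -> t < 1 -> W q t < W q s.
Hypothesis Z_gt0 : forall t, 0 < t < 1 -> 0 < Z t.
Hypothesis qs_gt0 : forall t, 0 < t < 1 -> 0 < qs t.
Hypothesis qs_anti : forall s t, 0 < s -> s < t -> t < 1 -> qs t <= qs s.
Hypothesis foc : forall t, 0 < t < 1 -> Z t * dW (qs t) t = dc (qs t) t.

Lemma dc_gt0 q t : 0 < q -> 0 < t < 1 -> 0 < dc q t.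
Proof. by move=> q0 t01; rewrite -(dc_0 t01) dc_q. Qed.

(** At [qs t] the first order condition gives [dW] the sign of [dc]; below [qs t] the derivative
    [dW] is at least as large. *)
Lemma dW_gt0 q t : 0 <= q -> 0 < t < 1 -> q <= qs t -> 0 < dW q t.
Proof.
move=> q0 t01 qq; apply: lt_le_trans (dW_q q0 qq t01).
have := dc_gt0 (qs_gt0 t01) t01; rewrite -foc//.
by rewrite pmulr_rgt0// Z_gt0.
Qed.

Lemma W_incr q q' t : 0 < t < 1 -> 0 <= q -> q < q' -> q' <= qs t -> W q t < W q' t.
Proof.
move=> t01 q0 qq' q's; apply: (@is_derive_incr _ (W ^~ t) (dW ^~ t)) => //.
  by apply: continuous_subspaceW (W_cont t01); exact: sub_qualities.
move=> x /andP[qx xq']; have x0 := le_lt_trans q0 qx.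
split; first exact: W_der.
by apply: dW_gt0 => //; [exact: ltW|exact: le_trans (ltW xq') q's].
Qed.

Definition score (t : R) := W (qs t) t.

(** Passing from [t] down to [s] raises the score twice: the virtual surplus grows at the fixed
    quality [qs t], and the quality then climbs to [qs s] inside the range where [W] increases. *)
Lemma score_decr s t : 0 < s -> s < t -> t < 1 -> score t < score s.
Proof.
move=> s0 st t1; have t01 : 0 < t < 1 by rewrite t1 (lt_trans s0).
have s01 : 0 < s < 1 by rewrite s0 (lt_trans st).
have /lt_le_trans := W_t (qs_gt0 t01) s0 st t1; apply.
have := qs_anti s0 st t1; rewrite le_eqVlt => /predU1P[->//|qq].
by apply/ltW/W_incr => //; exact/ltW/qs_gt0.
Qed.

(* [k] extends the interim winning probability from the scores of the solution,
   where it equals [Z], to all scores; [k_left] and [k_right] say so without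
   assuming that the scores fill an interval. *)
Context (k A : R -> R) (m : R).
Hypothesis k_ge0 : forall r, 0 <= k r.
Hypothesis k_left : forall r t e, 0 < e -> 0 < t < 1 -> score t <= r ->
  exists s, [/\ 0 < s, s <= t, score s <= r & k r < Z s + e].
Hypothesis k_right : forall r t e, 0 < e -> 0 < t < 1 -> r <= score t ->
  exists s, [/\ t <= s, s < 1, r <= score s & Z s < k r + e].
Hypothesis A_der : forall r, m < r -> is_derive r 1 A (k r).
Hypothesis A_ndecr : {homo A : x y / x <= y}.
Hypothesis W0_gtm : forall t, 0 < t < 1 -> m < W 0 t.

(** Let [s] be a type whose score is close to [W q t]. Then [s <= t] and [qs s <= q], and up to [e]
    the value [k (W q t)] is at most [Z s = dc (qs s) s / dW (qs s) s]. Since [dc] increases and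
    [dW] decreases in both arguments, this is at most [dc q t / dW q t]. *)
Lemma marginal_above q t : 0 < t < 1 -> qs t <= q -> score t <= W q t ->
  k (W q t) * dW q t <= dc q t.
Proof.
move=> t01 qq sW; have q0 := lt_le_trans (qs_gt0 t01) qq.
have [dW0|dW0] := leP (dW q t) 0.
  by apply: le_trans (ltW (dc_gt0 q0 t01)); rewrite mulr_ge0_le0.
rewrite -ler_pdivlMr//; apply/ler_addgt0Pr => e e0.
have [s [s0 st ss ks]] := k_left e0 t01 sW.
apply: le_trans (ltW ks) _; rewrite lerD2r ler_pdivlMr//.
have t1 : t < 1 by case/andP: t01.
have s01 : 0 < s < 1 by rewrite s0 (le_lt_trans st).
(* Otherwise [W q t < W q s < score s <= W q t]. *)
have qsq : qs s <= q.
  have [->//|/eqP sNt] := eqVneq s t; have {}st : s < t by rewrite lt_neqAle; apply/andP; split => //; apply/eqP.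
  rewrite leNgt; apply/negP => qqs; suff : W q t < W q t by rewrite ltxx.
  apply: lt_trans (W_t q0 s0 st t1) _; apply: lt_le_trans ss.
  by apply: W_incr => //; exact: ltW.
apply: le_trans (dc_t q0 s0 st t1).
have : dc (qs s) s <= dc q s.
  move: qsq; rewrite le_eqVlt => /predU1P[->//|qsq].
  by apply/ltW/dc_q => //; exact/ltW/qs_gt0.
apply: le_trans; rewrite -foc// ler_pM2l ?Z_gt0//.
by apply: le_trans (dW_t q0 s0 st t1) _; apply: dW_q => //; exact/ltW/qs_gt0.
Qed.

(** The mirror image of [marginal_above]: now the type [s] with score close to [W q t] satisfies
    [t <= s] and [q <= qs s], and all comparisons are reversed. *)
Lemma marginal_below q t : 0 < t < 1 -> 0 < q -> q <= qs t ->
  dc q t <= k (W q t) * dW q t.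
Proof.
move=> t01 q0 qq; have dW0 := dW_gt0 (ltW q0) t01 qq.
rewrite -ler_pdivrMr//; apply/ler_addgt0Pr => e e0.
have Ws : W q t <= score t.
  by move: qq; rewrite le_eqVlt => /predU1P[->//|qq]; apply/ltW/W_incr => //; exact: ltW.
have [s [ts s1 ss ks]] := k_right e0 t01 Ws.
apply: le_trans (ltW ks); rewrite ler_pdivrMr//.
have t0 : 0 < t by case/andP: t01.
have s01 : 0 < s < 1 by rewrite s1 (lt_le_trans t0).
have qsq : q <= qs s.
  have [<-//|/eqP sNt] := eqVneq t s; have {}ts : t < s by rewrite lt_neqAle; apply/andP; split => //; apply/eqP.
  rewrite leNgt; apply/negP => qqs; suff : W q t < W q t by rewrite ltxx.
  apply: le_lt_trans ss _; apply: lt_trans (W_t (qs_gt0 s01) t0 ts s1) _.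
  by apply: W_incr => //; exact/ltW/qs_gt0.
apply: le_trans (dc_t q0 t0 ts s1) _.
have : dc q s <= dc (qs s) s.
  move: qsq; rewrite le_eqVlt => /predU1P[->//|qsq].
  by apply/ltW/dc_q => //; exact: ltW.
move=> /le_trans; apply; rewrite -foc// ler_pM2l ?Z_gt0//.
by apply: le_trans (dW_t q0 t0 ts s1); apply: dW_q => //; exact: ltW.
Qed.

Let AW_cont t q1 q2 : 0 < t < 1 -> 0 <= q1 -> (forall x, q1 <= x <= q2 -> m < W x t) ->
  {within `[q1, q2], continuous (fun q => A (W q t))}.
Proof.
move=> t01 q10 mW; apply/within_continuousP => x /= xq.
have Wx : m < W x t by apply: mW; move: xq; rewrite in_itv.
have cA : {for W x t, continuous A}.
  by apply/differentiable_continuous/derivable1_diffP; have [] := A_der Wx.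
have /within_continuousP/(_ x xq) Wx' :=
  continuous_subspaceW (@sub_qualities R q1 q2 q10) (W_cont t01).
exact: (cvg_comp (W ^~ t) A Wx' cA).
Qed.

Let AW_der q t : 0 < t < 1 -> 0 < q -> m < W q t ->
  is_derive q 1 (fun q => A (W q t)) (k (W q t) * dW q t).
Proof.
move=> t01 q0 mW.
exact: (is_derive1_comp (f := A) (g := W ^~ t) (A_der mW) (W_der q0 t01)).
Qed.

Let c_cont_itv t q1 q2 : 0 < t < 1 -> 0 <= q1 -> {within `[q1, q2], continuous (c ^~ t)}.
Proof.
by move=> t01 q10; apply: continuous_subspaceW (c_cont t01); exact: sub_qualities.
Qed.

Lemma net_value_le q t : 0 < t < 1 -> 0 <= q ->
  A (W q t) - c q t <= A (score t) - c (qs t) t.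
Proof.
move=> t01 q0; have [qq|qq] := leP q (qs t).
  apply: (@is_derive_ndecr _ (fun q => A (W q t) - c q t)
    (fun q => k (W q t) * dW q t - dc q t)) => //.
    have mW y : q <= y <= qs t -> m < W y t.
      move=> /andP[qy yq]; apply: lt_le_trans (W0_gtm t01) _.
      have := le_trans q0 qy; rewrite le_eqVlt => /predU1P[<-//|y0].
      by apply/ltW/W_incr.
    apply/within_continuousP => x xq; apply: cvgB.
      by have /within_continuousP := @AW_cont t q (qs t) t01 q0 mW; exact.
    by have /within_continuousP := @c_cont_itv t q (qs t) t01 q0; exact.
  move=> x /andP[qx xq]; have x0 := le_lt_trans q0 qx; split.
    apply: is_deriveB; last exact: c_der.
    apply: AW_der => //; apply: lt_trans (W0_gtm t01) _.
    by apply: W_incr => //; exact: ltW.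
  by rewrite subr_ge0; apply: marginal_below => //; exact: ltW.
have q00 := qs_gt0 t01.
have c_le x : qs t <= x -> c (qs t) t <= c x t.
  move=> qx; apply: (@is_derive_ndecr _ (c ^~ t) (dc ^~ t)) => //.
    by apply: c_cont_itv => //; exact: ltW.
  move=> y /andP[qy yq]; have y0 := lt_trans q00 qy.
  by split; [exact: c_der|exact/ltW/dc_gt0].
have [Wq|Wq] := leP (W q t) (score t).
  by apply: lerB; [exact: A_ndecr|exact/c_le/ltW].
(* [W] is concave in the quality: had it dropped below [score t] before [q], its derivative would be
   negative from there on and it could not exceed [score t] at [q]. *)
have W_ge x : qs t <= x <= q -> score t <= W x t.
  rewrite le_eqVlt => /andP[/predU1P[<-//|qx] xq].
  rewrite leNgt; apply/negP => Wx.
  have [y] : exists2 y, y \in `]qs t, x[ & W x t - W (qs t) t = dW y t * (x - qs t).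
    apply: (@MVT _ (W ^~ t)) => //.
      by move=> y; rewrite in_itv /= => /andP[/(lt_trans q00) ? _]; exact: W_der.
    by apply: continuous_subspaceW (W_cont t01); apply/sub_qualities/ltW.
  rewrite in_itv /= => /andP[qy yx] e.
  have dWy : dW y t < 0.
    by rewrite -(pmulr_llt0 (x := x - qs t)) ?subr_gt0// -e subr_lt0.
  suff : W q t <= W x t by rewrite leNgt (lt_trans Wx).
  rewrite -lerN2; apply: (@is_derive_ndecr _ (fun x => - W x t) (fun x => - dW x t)) => //.
    apply/within_continuousP => z zq; apply: cvgN.
    have x0 : 0 <= x by apply/ltW/(lt_trans q00).
    by have /within_continuousP := continuous_subspaceW (@sub_qualities R x q x0) (W_cont t01); exact.
  move=> z /andP[xz zq]; have z0 : 0 < z by rewrite (lt_trans _ xz)// (lt_trans q00).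
  split; first by apply: is_deriveN; exact: W_der.
  rewrite oppr_ge0; apply: le_trans (ltW dWy); apply: dW_q => //.
    exact/ltW/(lt_trans q00).
  exact/ltW/(lt_trans yx).
have mW x : qs t <= x <= q -> m < W x t.
  move=> /W_ge; apply: lt_le_trans; apply: lt_trans (W0_gtm t01) _.
  exact: W_incr.
rewrite -lerN2 !opprB.
apply: (@is_derive_ndecr _ (fun q => c q t - A (W q t))
    (fun q => dc q t - k (W q t) * dW q t)) => //; first exact: ltW.
  apply/within_continuousP => x xq; apply: cvgB.
    by have /within_continuousP := @c_cont_itv t (qs t) q t01 (ltW q00); exact.
  by have /within_continuousP := @AW_cont t (qs t) q t01 (ltW q00) mW; exact.
move=> x /andP[qx xq]; have x0 := lt_trans q00 qx; split.
  by apply: is_deriveB; [exact: c_der|apply: AW_der => //; apply: mW; rewrite !ltW].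
rewrite subr_ge0; apply: marginal_above => //; first exact: ltW.
by apply: W_ge; rewrite !ltW.
Qed.

End virtual_surplus.

(** * Independent types *)

Section iid_types.
Context {R : realType} {d : measure_display} {T : measurableType d}.
Context (P : probability T R) (n : nat) (theta : 'I_n -> {RV P >-> R}) (F : R -> R).
Implicit Types (i j : 'I_n) (a b x : R) (A : set R).
Hypothesis theta_types : forall i w, types (theta i w).
Hypothesis theta_indep : mutually_independent theta.
Hypothesis theta_cdf : forall i x, cdf (theta i) x = (F x)%:E.

Let mtheta i A : measurable A -> measurable (theta i @^-1` A).
Proof. by move=> mA; exact: measurable_funPTI. Qed.

Lemma prob_le i x : P (theta i @^-1` `]-oo, x]) = (F x)%:E.
Proof. exact: theta_cdf. Qed.

Lemma prob_gt i x : P (theta i @^-1` `]x, +oo[) = (1 - F x)%:E.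
Proof.
have -> : `]x, +oo[%classic = ~` `]-oo, x] by rewrite setCitvl.
by rewrite preimage_setC probability_setC ?prob_le//; exact: (mtheta i (measurable_itv _)).
Qed.

(** The common distribution function gives equality on the open rays, a generating family stable
    under intersection, hence on all Borel sets. *)
Lemma identically_distributed i j A : measurable A ->
  P (theta i @^-1` A) = P (theta j @^-1` A).
Proof.
move=> mA; apply: (measure_unique (@RGenOInfty.G R) (fun k : nat => `]- k%:R, +oo[%classic)
  _ _ _ _ (distribution P (theta i)) (distribution P (theta j)) _ _ A mA).
- exact: RGenOInfty.measurableE.
- move=> _ _ [x ->] [y ->]; exists (Num.max x y).
  by apply/seteqP; split => z /=; rewrite !in_itv /= !andbT gt_max => /andP.
- by move=> k; exists (- k%:R).
- apply/seteqP; split => // x _; exists (Num.truncn `|x|).+1 => //=.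
  rewrite in_itv /= andbT ltrNl; apply: le_lt_trans _ (truncnS_gt _).
  by rewrite -normrN ler_norm.
- by move=> _ [x ->]; exact: etrans (prob_gt i x) (esym (prob_gt j x)).
- by move=> k; apply: (@le_lt_trans _ _ (1 - F (- k%:R))%:E); [rewrite -(prob_gt i)|rewrite ltry].
Qed.

Lemma prob_itv i a b : a <= b -> P (theta i @^-1` `]a, b]) = (F b - F a)%:E.
Proof.
move=> ab; have -> : `]a, b]%classic = `]-oo, b] `\` `]-oo, a].
  apply/seteqP; split => x /=; rewrite !in_itv /=.
    by move=> /andP[ax ->]; split => //; apply/negP; rewrite -ltNge.
  by move=> [-> /negP]; rewrite -ltNge => ->.
rewrite -[X in P X]/((theta i @^-1` `]-oo, b]) `\` (theta i @^-1` `]-oo, a])) measureD//; try exact: (mtheta i (measurable_itv _)); last first.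
  by rewrite -ge0_fin_numE// fin_num_measure//; exact: (mtheta i (measurable_itv _)).
rewrite (_ : _ `&` _ = theta i @^-1` `]-oo, a]); last first.
  apply/seteqP; split => w /=; rewrite !in_itv /=; first by case.
  by move=> wa; split => //; exact: le_trans ab.
by rewrite EFinB; congr (_ - _)%E; exact: prob_le.
Qed.

Context (M : R).
Hypothesis F0 : F 0 = 0.
Hypothesis F1 : F 1 = 1.
Hypothesis F_lip : forall s t, 0 <= s -> s <= t -> t <= 1 -> F t - F s <= M * (t - s).

(** For [x > 0] the point lies in intervals []y, x]] of length at most [e / M], whose probability
    the Lipschitz bound controls; for [x = 0] it lies in a ray of probability [F 0]. *)
Lemma prob_point i x : types x -> P (theta i @^-1` [set x]) = 0%E.
Proof.
move=> /in_types/andP[+ x1]; rewrite le_eqVlt => /predU1P[<-|x0]; apply/eqP;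
  rewrite eq_le measure_ge0 andbT.
  apply: (@le_trans _ _ (P (theta i @^-1` `]-oo, 0]))); last by rewrite prob_le F0.
  apply: le_measure; rewrite ?inE.
  - exact: (mtheta i (measurable_set1 _)).
  - exact: (mtheta i (measurable_itv _)).
  - by move=> w /= ->; rewrite in_itv /= lexx.
have M0 : 0 < M by have := F_lip (lexx 0) ler01 (lexx 1); rewrite F0 F1; lra.
apply/lee_addgt0Pr => e e0; rewrite add0e.
pose y := Num.max 0 (x - e / M).
have yx : y < x by rewrite gt_max x0 gtrBl divr_gt0.
have y0 : 0 <= y by rewrite le_max lexx.
apply: (@le_trans _ _ (P (theta i @^-1` `]y, x]))).
  apply: le_measure; rewrite ?inE.
  - exact: (mtheta i (measurable_set1 _)).
  - exact: (mtheta i (measurable_itv _)).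
  - by move=> w /= ->; rewrite in_itv /= lexx yx.
rewrite (prob_itv i (ltW yx)) lee_fin; apply: le_trans (F_lip y0 (ltW yx) x1) _.
have : x - e / M <= y by rewrite le_max lexx orbT.
by rewrite -ler_pdivlMl// mulrC; lra.
Qed.

Let measurable_tie i j : measurable [set w | theta i w = theta j w].
Proof.
rewrite (_ : mkset _ = (fun w => theta i w - theta j w) @^-1` [set 0]).
  by rewrite -[X in measurable X]setTI; apply: measurable_funB.
by apply/seteqP; split => w /= /eqP; [rewrite -subr_eq0|rewrite subr_eq0] => /eqP.
Qed.

(** Cut []0, 1]] into [N] equal cells. Tied types lie in the same cell, and by independence each
    cell contains both with probability at most [(M / N) ^+ 2], so a tie has probability at most
    [M * M / N]. The cells leave out type 0, which is null by [prob_point]. *)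
Lemma prob_tie i j : i != j -> P [set w | theta i w = theta j w] = 0%E.
Proof.
move=> ij; have mtie := measurable_tie i j.
have M0 : 0 < M by have := F_lip (lexx 0) ler01 (lexx 1); rewrite F0 F1; lra.
apply/eqP; rewrite eq_le measure_ge0 andbT; apply/lee_addgt0Pr => e e0; rewrite add0e.
have [N N0 Ne] : exists2 N : nat, (0 < N)%N & M * M / N%:R <= e.
  exists (Num.truncn (M * M / e)).+1 => //.
  rewrite ler_pdivrMr ?ltr0n// -ler_pdivrMl// mulrC.
  by apply/ltW; exact: truncnS_gt.
have N0' : 0 < N%:R :> R by rewrite ltr0n.
pose cell (k : nat) : set R := `](k%:R / N%:R), (k.+1%:R / N%:R)]%classic.
pose both k := theta i @^-1` cell k `&` theta j @^-1` cell k.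
have mboth k : measurable (both k) by apply: measurableI; exact: (mtheta _ (measurable_itv _)).
have cellP l k : P (theta l @^-1` cell k) = (F (k.+1%:R / N%:R) - F (k%:R / N%:R))%:E.
  by apply: prob_itv; rewrite ler_pM2r ?invr_gt0// ler_nat.
have cell_le k : (k < N)%N -> 0 <= F (k.+1%:R / N%:R) - F (k%:R / N%:R) <= M / N%:R.
  move=> kN; rewrite -lee_fin -(cellP i k) measure_ge0 /=.
  apply: le_trans (F_lip _ _ _) _.
  - by rewrite divr_ge0.
  - by rewrite ler_pM2r ?invr_gt0// ler_nat.
  - by rewrite ler_pdivrMr// mul1r ler_nat.
  - by rewrite -mulrBl -natrB ?subSnn ?mul1r.
have bothP k : (k < N)%N -> (P (both k) <= (M / N%:R * (M / N%:R))%:E)%E.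
  move=> kN; rewrite (_ : both k = \bigcap_(l in [set` [set i; j]%SET]) (theta l @^-1` cell k)).
    rewrite (@theta_indep [set i; j]%SET (fun=> cell k)); last by move=> _; exact: measurable_itv.
    rewrite big_setU1 ?inE//= big_set1 !cellP -EFinM lee_fin.
    by have /andP[? ?] := cell_le k kN; exact: ler_pM.
  apply/seteqP; split => w /=.
    by move=> [wi wj] l /=; rewrite !inE => /orP[] /eqP ->.
  by move=> h'; split; apply: h'; rewrite /= !inE eqxx ?orbT.
have sub : [set w | theta i w = theta j w] `<=`
    theta i @^-1` [set 0] `|` \big[setU/set0]_(k < N) both k.
  move=> w /= wij; have /in_types/andP[+ w1] := theta_types i w.
  rewrite le_eqVlt => /predU1P[<-|w0]; [by left|right].
  have ex : exists k, theta i w <= k.+1%:R / N%:R.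
    by exists N.-1; rewrite prednK// divff// gt_eqF.
  case: (ex_minnP ex) => k wk kmin; rewrite -(bigcup_mkord N both); exists k => /=.
    by rewrite -(prednK N0) ltnS; apply: kmin; rewrite prednK// divff// gt_eqF.
  have wc : cell k (theta i w).
    rewrite /cell /= in_itv /= wk andbT; case: k kmin {wk} => [|k] kmin; first by rewrite mul0r.
    by rewrite ltNge; apply/negP => /kmin; rewrite ltnn.
  by split => //=; rewrite -wij.
apply: le_trans (le_measure _ _ _ sub) _; rewrite ?inE//.
  by apply: measurableU; [exact: (mtheta i (measurable_set1 _))|exact: bigsetU_measurable].
apply: (@le_trans _ _ (P (theta i @^-1` [set 0%R]) +
    P (\big[setU/set0]_(k < N) both k))%E).
  by apply: measureU2; [exact: (mtheta i (measurable_set1 _))|exact: bigsetU_measurable].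
rewrite prob_point ?add0e; last by apply/in_types; rewrite lexx ler01.
apply: (@le_trans _ _ (\sum_(k < N) P (both k))%E); first exact: Boole_inequality.
apply: (@le_trans _ _ (\sum_(k < N) (M / N%:R * (M / N%:R))%:E)%E).
  by apply: lee_sum => k _; exact: bothP.
rewrite sumEFin lee_fin sumr_const card_ord -mulr_natr.
apply: le_trans Ne; rewrite le_eqVlt; apply/orP; left; apply/eqP; field.
by rewrite gt_eqF.
Qed.

(** All pointwise comparisons of revenues are made on this event: costs are controlled at interior
    types, and without ties [z_sym] selects exactly one firm. *)
Lemma ae_distinct_interior :
  {ae P, forall w, (forall i, 0 < theta i w < 1) /\
                   (forall i j, i != j -> theta i w <> theta j w)}.
Proof.
have neg (A : set T) : measurable A -> P A = 0%E -> {ae P, forall w, ~ A w}.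
  by move=> mA PA; apply/negligibleP => //; rewrite setCK.
have int : {ae P, forall w, forall i, 0 < theta i w < 1}.
  apply: filter_forall => i.
  have h x : types x -> {ae P, forall w, theta i w <> x}.
    by move=> Tx; apply: (neg (theta i @^-1` [set x])); [exact: (mtheta i (measurable_set1 _))|exact: prob_point].
  have h0 := h 0; have h1 := h 1.
  near=> w.
  have /in_types/andP[w0 w1] := theta_types i w.
  rewrite !lt_neqAle w0 w1 !andbT eq_sym; apply/andP; split; apply/eqP; near: w.
  - by apply: h0; apply/in_types; rewrite lexx ler01.
  - by apply: h1; apply/in_types; rewrite lexx ler01.
have tie : {ae P, forall w, forall i j, i != j -> theta i w <> theta j w}.
  apply: filter_forall => i; apply: filter_forall => j.
  have [->|ij] := eqVneq i j; first by near=> w.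
  near=> w; move=> _; near: w; apply: (neg [set w | theta i w = theta j w]).
    exact: measurable_tie.
  exact: prob_tie.
by near=> w; split; near: w.
Unshelve. all: by end_near. Qed.

End iid_types.

(** * The expected loss of a score function, level by level *)

Section layer_cake.
Context {R : realType} {d : measure_display} {T : measurableType d}.
Context (P : probability T R) (n : nat) (theta : 'I_n -> {RV P >-> R}).
Implicit Types (i j : 'I_n) (r x : R) (s : R -> R) (w : T).
Hypothesis theta_indep : mutually_independent theta.
Hypothesis theta_law : forall i j (A : set R), measurable A ->
  P (theta i @^-1` A) = P (theta j @^-1` A).
Context (K : R -> R) (m M : R).
Hypothesis K_cont : continuous K.
Hypothesis K_ge0 : forall r, 0 <= K r.
Hypothesis K_le1 : forall r, K r <= 1.
Hypothesis mM : m <= M.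

Local Notation mu := (@lebesgue_measure R).
Let k r : R := K r ^+ n.-1.

(** The default [m] of the maximum is a floor: the score functions that are compared below take
    values in [[m, M]]. *)
Definition top_score s w : R := \big[Num.max/m]_(i < n) s (theta i w).

(* By integration by parts this is [E max(0, r - Y)], where [Y >= m] is the
   highest of [n.-1] independent scores with distribution function [K]. *)
Definition option_value r : R := \int[mu]_(x in `[m, r]) (K x ^+ n.-1).

(** The constant [M] makes the loss nonnegative for scores at most [M], as Tonelli's theorem
    requires. *)
Definition score_loss s w : R :=
  M - top_score s w + \sum_(i < n) option_value (s (theta i w)).

Let k_ge0 r : 0 <= k r. Proof. exact: exprn_ge0. Qed.

Let k_le1 r : k r <= 1. Proof. by rewrite exprn_ile1. Qed.

Let k_cont : continuous k.
Proof.
move=> r; apply: (cvg_comp K (fun x => x ^+ n.-1)); first exact: K_cont.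
exact: exprn_continuous.
Qed.

Let mk (A : set R) : measurable_fun A k.
Proof. by apply: measurable_funTS; exact: continuous_measurable_fun. Qed.

Let k_integrable (a b : R) : mu.-integrable `[a, b] (EFin \o k).
Proof.
apply: continuous_compact_integrable; first exact: segment_compact.
exact: continuous_subspaceT.
Qed.

Lemma le_top_score s w i : s (theta i w) <= top_score s w.
Proof. exact: (le_bigmax_cond _ (fun i => s (theta i w))). Qed.

Lemma top_score_le s w x : (top_score s w <= x) = (m <= x) && [forall i, s (theta i w) <= x].
Proof.
apply/bigmax_leP/andP => -[mx h]; split => //.
  by apply/forallP => i; exact: h.
by move=> i _; exact: (forallP h).
Qed.

Lemma option_value_ge0 r : 0 <= option_value r.
Proof. by apply: Rintegral_ge0 => x _; exact: k_ge0. Qed.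

Lemma option_value_le r : r <= M -> option_value r <= M - m.
Proof.
move=> rM; rewrite -lee_fin /option_value /Rintegral fineK; last first.
  by apply: integrable_fin_num => //; exact: k_integrable.
apply: (@le_trans _ _ (\int[mu]_(x in `[m, M]) (cst 1 x))%E).
  apply: (@le_trans _ _ (\int[mu]_(x in `[m, M]) (k x)%:E)%E).
    apply: ge0_subset_integral => //=.
    - by apply/measurable_EFinP; exact: mk.
    - by move=> x _; rewrite lee_fin; exact: k_ge0.
    - by apply: subset_itvl; rewrite bnd_simp.
  apply: ge0_le_integral => //=.
  - by move=> x _; rewrite lee_fin; exact: k_ge0.
  - by apply/measurable_EFinP; exact: mk.
  - by move=> x _; rewrite lee_fin; exact: k_le1.
rewrite integral_cst//= mul1e lebesgue_measure_itv /= lte_fin.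
by case: ifPn => // _; rewrite lee_fin subr_ge0.
Qed.

Section bounded_score.
Context (s : R -> R).
Hypothesis ms : measurable_fun setT s.
Hypothesis s_le : forall x, s x <= M.

Lemma score_loss_ge0 w : 0 <= score_loss s w.
Proof.
apply: addr_ge0.
  by rewrite subr_ge0 top_score_le mM; apply/forallP.
by apply: sumr_ge0 => i _; exact: option_value_ge0.
Qed.

Lemma score_loss_le w : score_loss s w <= (M - m) *+ n.+1.
Proof.
rewrite mulrS lerD//.
  by rewrite lerB// (_ : m <= top_score s w)//; exact: bigmax_ge_id.
rewrite -[X in _ *+ X]card_ord -sumr_const; apply: ler_sum => i _.
exact: option_value_le.
Qed.

(** The sections at [w] are sets of levels [r]: [M - top_score s w] is the length of the levels that
    no score exceeds, and [option_value (s (theta i w))] is the integral of [k] over the levels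
    below the score of firm [i]. *)
Let all_below : set (T * R) :=
  [set p | m <= p.2 <= M /\ forall i, s (theta i p.1) <= p.2].

Let below i : set (T * R) := [set p | m <= p.2 <= M /\ p.2 < s (theta i p.1)].

Let layers (p : T * R) : \bar R :=
  (\1_all_below p)%:E + (\sum_(i < n) (k p.2 * \1_(below i) p)%:E)%E.

Let msth i : measurable_fun setT (fun p : T * R => s (theta i p.1)).
Proof. by apply: measurableT_comp => //; apply: measurableT_comp => //. Qed.

Let mitv : measurable [set p : T * R | m <= p.2 <= M].
Proof.
rewrite -[X in measurable X]setTI.
rewrite (_ : [set p | _] = snd @^-1` `[m, M]%classic); last first.
  by apply/seteqP; split => p /=; rewrite in_itv.
by apply: measurable_snd.
Qed.

Let mall_below : measurable all_below.
Proof.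
rewrite (_ : all_below = [set p | m <= p.2 <= M] `&`
    \bigcap_(i in [set: 'I_n]) [set p | s (theta i p.1) <= p.2]); last first.
  by apply/seteqP; split => p /= [? h]; split => // i; [move=> _|]; exact: h.
apply: measurableI => //; apply: fin_bigcap_measurable => // i _.
rewrite -[X in measurable X]setTI.
by apply: measurable_fun_le => //; exact: measurable_snd.
Qed.

Let mbelow i : measurable (below i).
Proof.
rewrite (_ : below i = [set p | m <= p.2 <= M] `&` ~` [set p | s (theta i p.1) <= p.2]).
  apply: measurableI => //; apply: measurableC; rewrite -[X in measurable X]setTI.
  by apply: measurable_fun_le => //; exact: measurable_snd.
by apply/seteqP; split => p /= [? h]; split => //; [apply/negP|move/negP: h]; rewrite -ltNge.
Qed.

Let mlayer i : measurable_fun setT (fun p : T * R => (k p.2 * \1_(below i) p)%:E).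
Proof.
apply/measurable_EFinP; apply: measurable_funM; last exact: measurable_indic.
by apply: measurableT_comp; [exact: mk|exact: measurable_snd].
Qed.

Let mlayers : measurable_fun setT layers.
Proof.
apply: emeasurable_funD; first by apply/measurable_EFinP; exact: measurable_indic.
exact: emeasurable_sum.
Qed.

Let mall_below1 w : measurable_fun setT (fun r => (\1_all_below (w, r))%:E : \bar R).
Proof.
have h : measurable_fun setT (\1_all_below : T * R -> R) by exact: measurable_indic.
by apply/measurable_EFinP; exact: (measurable_fun_pair2 w h).
Qed.

Let mall_below2 r : measurable_fun setT (fun w => (\1_all_below (w, r))%:E : \bar R).
Proof.
have h : measurable_fun setT (\1_all_below : T * R -> R) by exact: measurable_indic.
by apply/measurable_EFinP; exact: (measurable_fun_pair1 r h).
Qed.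

Let mlayer1 w i : measurable_fun setT (fun r => (k r * \1_(below i) (w, r))%:E).
Proof. exact: (measurable_fun_pair2 w (mlayer i)). Qed.

Let mlayer2 r i : measurable_fun setT (fun w => (k r * \1_(below i) (w, r))%:E).
Proof. exact: (measurable_fun_pair1 r (mlayer i)). Qed.

Let layer_ge0 w r i : (0 <= (k r * \1_(below i) (w, r))%:E)%E.
Proof. by rewrite lee_fin mulr_ge0. Qed.

Let layers_integral1 w : (\int[mu]_r layers (w, r) = \int[mu]_r (\1_all_below (w, r))%:E +
  \sum_(i < n) \int[mu]_r (k r * \1_(below i) (w, r))%:E)%E.
Proof.
rewrite -(ge0_integral_sum mu measurableT (mlayer1 w) (fun i r _ => layer_ge0 w r i)).
apply: (ge0_integralD mu measurableT _ (mall_below1 w) _ (emeasurable_sum _ (mlayer1 w))).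
- by move=> r _; rewrite lee_fin.
- by move=> r _; apply: sume_ge0 => i _; exact: layer_ge0.
Qed.

Let layers_integral2 r : (\int[P]_w layers (w, r) = \int[P]_w (\1_all_below (w, r))%:E +
  \sum_(i < n) \int[P]_w (k r * \1_(below i) (w, r))%:E)%E.
Proof.
rewrite -(ge0_integral_sum P measurableT (mlayer2 r) (fun i w _ => layer_ge0 w r i)).
apply: (ge0_integralD P measurableT _ (mall_below2 r) _ (emeasurable_sum _ (mlayer2 r))).
- by move=> w _; rewrite lee_fin.
- by move=> w _; apply: sume_ge0 => i _; exact: layer_ge0.
Qed.

Let layers_ge0 p : (0 <= layers p)%E.
Proof.
apply: adde_ge0; first by rewrite lee_fin.
by apply: sume_ge0 => i _; rewrite lee_fin mulr_ge0.
Qed.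

Let mlayersR : measurable_fun setT (layers : T * measurableTypeR R -> \bar R).
Proof. exact: mlayers. Qed.

Lemma score_loss_layers w : (score_loss s w)%:E = (\int[mu]_r layers (w, r))%E.
Proof.
rewrite layers_integral1.
rewrite /score_loss EFinD -sumEFin; congr (_ + _)%E.
  rewrite (_ : (fun r => _) = (fun r => (\1_(`[top_score s w, M]%classic) r)%:E)); last first.
    apply/funext => r; congr (_%:E); congr (_%:R); congr nat_of_bool.
    apply/idP/idP; rewrite !inE /= in_itv /= top_score_le.
      by move=> [/= /andP[mr rM] h]; rewrite mr rM andbT /=; exact/forallP.
    by move=> /andP[/andP[mr /forallP h] rM]; split => //=; rewrite mr.
  rewrite integral_indic// setIT.
  apply/esym/(etrans (lebesgue_measure_itv `[top_score s w, M])); rewrite /= lte_fin.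
  have : top_score s w <= M by rewrite top_score_le mM; apply/forallP.
  by case: ltgtP => //= -> _; rewrite subrr.
apply: eq_bigr => i _.
rewrite /option_value /Rintegral fineK; last first.
  by apply: integrable_fin_num => //; exact: k_integrable.
(* The level equal to the score is negligible; opening that end matches the strict inequality in
   [below]. *)
rewrite -(@integral_itv_bndo_bndc _ _ _ (EFin \o k)); last first.
  by apply/measurable_EFinP; exact: mk.
rewrite integral_mkcond; apply: eq_integral => r _.
rewrite patchE /=; case: ifPn => [|h].
  rewrite inE /= in_itv /= => /andP[mr rs].
  rewrite indicE mem_set ?mulr1//=; split => //=; rewrite mr /=.
  exact: le_trans (ltW rs) (s_le _).
rewrite indicE memNset ?mulr0//= => -[/andP[mr _] rs]; move/negP: h; apply.
by rewrite inE /= in_itv /= mr.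
Qed.

Lemma measurable_score_loss : measurable_fun setT (score_loss s).
Proof.
apply/measurable_EFinP.
rewrite (_ : EFin \o _ = fubini_F mu layers); last first.
  by apply/funext => w; exact: score_loss_layers.
exact: measurable_fun_fubini_tonelli_F.
Qed.

(** Tonelli's theorem integrates over profiles at a fixed level. There independence turns
    [all_below] into an [n]-th power, and the common law makes the [n] sets [below] contribute
    equally, so a single firm [i] represents all. [G] carries its measurability because two such
    integrals are compared later. *)
Lemma expected_score_loss i : exists G : R -> \bar R,
  [/\ measurable_fun setT G, forall r, (0 <= G r)%E,
      (\int[P]_w (score_loss s w)%:E = \int[mu]_r G r)%E &
      forall r, G r = if m <= r <= M then
        (P [set w | (s (theta i w) <= r)%R] ^+ n +
         (k r *+ n)%:E * P (~` [set w | (s (theta i w) <= r)%R]))%E else 0%E].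
Proof.
exists (fubini_G P (layers : T * measurableTypeR R -> \bar R)); split.
- exact: (measurable_fun_fubini_tonelli_G (m1 := P) layers mlayersR layers_ge0).
- by move=> r; apply: integral_ge0.
- under eq_integral do rewrite score_loss_layers.
  exact: (@fubini_tonelli _ _ T (measurableTypeR R) R P mu layers mlayersR layers_ge0).
move=> r; rewrite /fubini_G.
pose A j : set T := [set w | s (theta j w) <= r].
have mA' : measurable [set x | s x <= r].
  by rewrite -[X in measurable X]setTI; exact: (measurable_fun_le measurableT ms (measurable_cst r)).
have mA j : measurable (A j) by exact: (measurable_funPTI (theta j) mA').
have PA j : P (A j) = P (A i) by exact: (theta_law j i mA').
rewrite layers_integral2.
case: ifPn => [|h]; last first.
  have rmM : ~ m <= r <= M by exact/negP.
  rewrite integral0_eq ?add0e; last first.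
    by move=> w _; rewrite indicE memNset//= => -[].
  rewrite big1// => j _; rewrite integral0_eq// => w _.
  by rewrite indicE memNset ?mulr0//= => -[].
move=> rmM; congr (_ + _)%E.
  rewrite (_ : (fun w => _) = (fun w => (\1_(\bigcap_(j in [set` [set: 'I_n]%SET]) A j) w)%:E)); last first.
    apply/funext => w; congr (_%:E); congr (_%:R); congr nat_of_bool.
    apply/idP/idP; rewrite !inE /=; first by move=> [_ h] j _; exact: h.
    by move=> h; split => // j; apply: h; rewrite /= inE.
  rewrite integral_indic//; last by apply: fin_bigcap_measurable.
  rewrite setIT; apply: (etrans (@theta_indep [set: 'I_n]%SET (fun=> [set x | s x <= r]) (fun=> mA'))).
  rewrite (eq_bigr (fun=> P (A i))); last by move=> j _; exact: PA.
  rewrite big_const cardsT card_ord /A; move: (P _) => a; elim: (n) => [//|q IH].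
  by rewrite expeS -IH.
have PB : (P (~` A i) = (fine (P (~` A i)))%:E) by rewrite fineK// fin_num_measure//; exact: measurableC.
rewrite (eq_bigr (fun=> (k r)%:E * P (~` A i))%E); last first.
  move=> j _; have h : measurable_fun setT (\1_(below j) : T * R -> R) by exact: measurable_indic.
  have h1 : measurable_fun setT (fun w => (\1_(below j) (w, r))%:E : \bar R).
    by apply/measurable_EFinP; exact: (measurable_fun_pair1 r h).
  apply: (etrans (ge0_integralZl P measurableT h1 (fun w _ => _) (_ : 0 <= (k r)%:E)%E)).
  - by move=> w _; rewrite lee_fin.
  - by rewrite lee_fin.
  congr (_ * _)%E.
  rewrite (_ : (fun w => _) = (fun w => (\1_(~` A j) w)%:E)); last first.
    apply/funext => w; congr (_%:E); congr (_%:R); congr nat_of_bool.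
    apply/idP/idP; rewrite !inE /=; first by move=> [_ ?]; apply/negP; rewrite -ltNge.
    by move=> /negP; rewrite -ltNge.
  rewrite integral_indic ?setIT//; last exact: measurableC.
  exact: (theta_law j i (measurableC mA')).
rewrite PB -EFinM sumEFin sumr_const card_ord -mulrnAl -EFinM.
by [].
Qed.

End bounded_score.

(** The gap between the power and its tangent at [y] obeys a recursion with nonnegative terms: the
    next gap is [x] times the present one plus [q.+1%:R * y ^+ q * (x - y) ^+ 2]. *)
Lemma tangent_power (x y : R) q : 0 <= x -> 0 <= y ->
  y ^+ q.+1 + q.+1%:R * y ^+ q * (x - y) <= x ^+ q.+1.
Proof.
move=> x0 y0; rewrite -subr_ge0; elim: q => [|q IH]; first by rewrite !expr1 !expr0; lra.
have -> : x ^+ q.+2 - (y ^+ q.+2 + q.+2%:R * y ^+ q.+1 * (x - y)) =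
    x * (x ^+ q.+1 - (y ^+ q.+1 + q.+1%:R * y ^+ q * (x - y))) +
    q.+1%:R * y ^+ q * (x - y) ^+ 2.
  by rewrite !exprS -[in q.+2%:R]addn1 natrD; move: q.+1%:R (x ^+ q) (y ^+ q) => a b c; ring.
apply: addr_ge0; first exact: mulr_ge0.
by apply: mulr_ge0; [apply: mulr_ge0 => //; exact: exprn_ge0|exact: sqr_ge0].
Qed.

(* Layer by layer, [H ^+ n + n K ^+ n.-1 (1 - H)] is minimal at [H = K]. *)
Lemma expected_score_loss_min s sopt : (0 < n)%N ->
  measurable_fun setT s -> (forall x, m <= s x <= M) ->
  measurable_fun setT sopt -> (forall x, m <= sopt x <= M) ->
  (forall i r, m <= r <= M -> P [set w | sopt (theta i w) <= r] = (K r)%:E) ->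
  (\int[P]_w (score_loss sopt w)%:E <= \int[P]_w (score_loss s w)%:E)%E.
Proof.
move=> n0 ms sb mo ob oK; pose i := Ordinal n0.
have s2 x : s x <= M by have /andP[] := sb x.
have o2 x : sopt x <= M by have /andP[] := ob x.
have PC (g : R -> R) r : measurable_fun setT g -> exists2 H : R, 0 <= H <= 1 &
    P [set w | g (theta i w) <= r] = H%:E /\ P (~` [set w | g (theta i w) <= r]) = (1 - H)%:E.
  move=> mg; have mA : measurable [set w | g (theta i w) <= r].
    have mA' : measurable [set x | g x <= r].
      by rewrite -[X in measurable X]setTI; exact: (measurable_fun_le measurableT mg (measurable_cst r)).
    exact: (measurable_funPTI (theta i) mA').
  exists (fine (P [set w | g (theta i w) <= r])).
    by rewrite -!lee_fin fineK ?fin_num_measure// measure_ge0 probability_le1.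
  by rewrite EFinB probability_setC// fineK ?fin_num_measure.
have [G [mG G0 -> GE]] := expected_score_loss mo o2 i.
have [H [mH H0 -> HE]] := expected_score_loss ms s2 i.
apply: ge0_le_integral => // r _; rewrite GE HE; case: ifPn => // rmM.
have [h /andP[h0 h1] [-> ->]] := PC s r ms.
have [h' _ []] := PC sopt r mo; rewrite oK// => -[<-] ->.
rewrite -!EFin_expe -!EFinM -!EFinD lee_fin.
(* The tangent of the [n]-th power at [K r], evaluated at [h]: its slope [n * K r ^+ n.-1] is the
   weight of the linear term of the layer. *)
have := tangent_power n.-1 h0 (K_ge0 r); rewrite prednK// -[k r *+ n]mulr_natl /k.
move: (K r ^+ n) (h ^+ n) (K r ^+ n.-1) => a b c; lra.
Qed.

End layer_cake.

(** * The winning probability of a score, through a generalized inverse *)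

Section winning_probability.
Context {R : realType} (F g : R -> R) (n : nat).
Implicit Types (r s t x e : R).
Hypothesis F_cont : {within types, continuous F}.
Hypothesis F0 : F 0 = 0.
Hypothesis F1 : F 1 = 1.
Hypothesis F_incr : forall s t, 0 <= s -> s < t -> t <= 1 -> F s < F t.
Hypothesis g_decr : forall s t, 0 < s -> s < t -> t < 1 -> g t < g s.

(** The point 0 keeps the set nonempty: a score that no interior type exceeds gets the cutoff 0,
    hence winning probability 1. *)
Let high r : set R := [set t | t = 0 \/ 0 < t < 1 /\ r < g t].

(* [cutoff r] is the type whose score [g] is [r], when there is one. *)
Definition cutoff r : R := sup (high r).

Let high_sup r : has_sup (high r).
Proof.
split; first by exists 0; left.
by exists 1 => t [->|[/andP[_ /ltW]]].
Qed.

Lemma cutoff_ge0 r : 0 <= cutoff r.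
Proof. by apply: sup_upper_bound; [exact: high_sup|left]. Qed.

Lemma cutoff_le1 r : cutoff r <= 1.
Proof.
apply: ge_sup; first by case: (high_sup r).
by move=> t [->|[/andP[_ /ltW]]].
Qed.

Lemma cutoff_types r : types (cutoff r).
Proof. by apply/in_types; rewrite cutoff_ge0 cutoff_le1. Qed.

Lemma le_cutoff r t : 0 < t < 1 -> r < g t -> t <= cutoff r.
Proof. by move=> t01 rg; apply: sup_upper_bound; [exact: high_sup|right]. Qed.

Lemma gt_cutoff r t : cutoff r < t -> t < 1 -> g t <= r.
Proof.
move=> ct t1; rewrite leNgt; apply/negP => rg; suff : t <= cutoff r by rewrite leNgt ct.
by apply: le_cutoff => //; rewrite t1 (le_lt_trans (cutoff_ge0 r)).
Qed.

Lemma lt_cutoff r t : 0 < t -> t < cutoff r -> r < g t.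
Proof.
move=> t0 tc; have [s [->|[/andP[s0 s1] rs] ts]] := sup_gt (ex_intro _ 0 (or_introl erefl) : high r !=set0) tc.
  by rewrite ltNge ltW.
exact: lt_trans rs (g_decr t0 ts s1).
Qed.

(** Strict monotonicity of [g] makes its generalized inverse continuous: a jump of [g] is a plateau
    of [cutoff], while a jump of [cutoff] would require a plateau of [g]. *)
Lemma cutoff_continuous : continuous cutoff.
Proof.
move=> r; apply/cvgrPdist_lt => e e0.
have c0 := cutoff_ge0 r; have c1 := cutoff_le1 r.
have up : \forall x \near r, cutoff x < cutoff r + e.
  have [t1|t1] := leP 1 (cutoff r + e / 2).
    near=> x; apply: le_lt_trans (cutoff_le1 x) _; lra.
  (* Beyond the cutoff the comparison with [r] is weak; moving on from [e / 4] to [e / 2] makes it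
     strict and therefore stable near [r]. *)
  have gr : g (cutoff r + e / 4) <= r by apply: gt_cutoff; lra.
  have gt : g (cutoff r + e / 2) < r by apply: lt_le_trans gr; apply: g_decr; lra.
  near=> x; have xt : g (cutoff r + e / 2) < x by near: x; exact: lt_nbhsr.
  apply: (@le_lt_trans _ _ (cutoff r + e / 2)); last lra.
  have t0 : 0 < cutoff r + e / 2 by lra.
  by rewrite leNgt; apply/negP => /(lt_cutoff t0); rewrite ltNge ltW.
have dn : \forall x \near r, cutoff r - e < cutoff x.
  have [t0|t0] := leP (cutoff r - e / 2) 0.
    near=> x; apply: lt_le_trans (cutoff_ge0 x); lra.
  have gr : r < g (cutoff r - e / 4) by apply: lt_cutoff; lra.
  have gt : r < g (cutoff r - e / 2) by apply: lt_trans gr _; apply: g_decr; lra.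
  near=> x; have xt : x < g (cutoff r - e / 2) by near: x; exact: lt_nbhsl.
  apply: (@lt_le_trans _ _ (cutoff r - e / 2)); first lra.
  by apply: le_cutoff => //; rewrite t0 /=; lra.
near=> x; rewrite ltr_distlC; apply/andP; split; by near: x.
Unshelve. all: by end_near. Qed.

(** The probability of beating one rival, whose type must exceed the cutoff; it is also the
    distribution function of the rival's score. The power [n.-1] accounts for all rivals. *)
Definition win_prob r : R := 1 - F (cutoff r).

Lemma win_prob_continuous : continuous win_prob.
Proof.
move=> r; apply: cvgB; first exact: cvg_cst.
have /within_continuousP/(_ _ (cutoff_types r)) Fc := F_cont.
apply: (cvg_comp cutoff F _ Fc) => A wA.
have := @cutoff_continuous r _ wA; apply: (@filterS _ (nbhs r)) => x Ax.
exact: Ax (cutoff_types x).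
Qed.

Let F_ndecr s t : 0 <= s -> s <= t -> t <= 1 -> F s <= F t.
Proof.
by move=> s0; rewrite le_eqVlt => /predU1P[->//|st] t1; exact/ltW/F_incr.
Qed.

Lemma win_prob_ge0 r : 0 <= win_prob r.
Proof. by rewrite subr_ge0 -F1 F_ndecr ?cutoff_ge0 ?cutoff_le1. Qed.

Lemma win_prob_le1 r : win_prob r <= 1.
Proof. by rewrite gerBl -F0 F_ndecr ?cutoff_ge0 ?cutoff_le1. Qed.

Let Z t : R := (1 - F t) ^+ n.-1.

Let Z_near r e : 0 < e -> exists2 d : R, 0 < d &
  forall s, types s -> `|cutoff r - s| < d -> `|win_prob r ^+ n.-1 - Z s| < e.
Proof.
move=> e0.
have /within_continuousP/(_ _ (cutoff_types r)) Fc := F_cont.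
have : Z s @[s --> within types (nbhs (cutoff r))] --> Z (cutoff r).
  by apply: (@cvg_comp _ _ _ (fun s => 1 - F s) (fun x => x ^+ n.-1) _ (nbhs (1 - F (cutoff r))));
    [by apply: cvgB => //; exact: cvg_cst|exact: exprn_continuous].
move=> /cvgrPdist_lt/(_ _ e0); rewrite near_withinE => /nbhs_ballP[d /= d0 h].
by exists d => // s Ts sd; exact: (h s).
Qed.

(** The witness lies slightly to the right of the cutoff, where scores are at most [r] and [Z] is
    still close to its value at the cutoff. If the cutoff is [t], then [t] itself serves. *)
Lemma win_prob_left r t e : 0 < e -> 0 < t < 1 -> g t <= r ->
  exists s, [/\ 0 < s, s <= t, g s <= r & win_prob r ^+ n.-1 < Z s + e].
Proof.
move=> e0 /andP[t0 t1] gr.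
have : cutoff r <= t by rewrite leNgt; apply/negP => /(lt_cutoff t0); rewrite ltNge gr.
rewrite le_eqVlt => /predU1P[ct|ct].
  by exists t; split => //; rewrite /win_prob ct ltrDl.
have [d d0 h] := Z_near r e0; have c0 := cutoff_ge0 r.
pose s := Num.min (cutoff r + d / 2) t.
have st : s <= t by rewrite ge_min lexx orbT.
have sd : s <= cutoff r + d / 2 by rewrite ge_min lexx.
have cs : cutoff r < s by rewrite lt_min ct andbT ltrDl divr_gt0.
have s0 : 0 < s by exact: le_lt_trans cs.
exists s; split => //; first by apply: gt_cutoff => //; exact: le_lt_trans t1.
have /h : types s by apply/interior_types; rewrite s0 (le_lt_trans st).
rewrite distrC gtr0_norm ?subr_gt0// => H; apply/ltr_distlDr/H; lra.
Qed.

(** Symmetric to [win_prob_left], with a witness slightly to the left of the cutoff. *)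
Lemma win_prob_right r t e : 0 < e -> 0 < t < 1 -> r <= g t ->
  exists s, [/\ t <= s, s < 1, r <= g s & Z s < win_prob r ^+ n.-1 + e].
Proof.
move=> e0 /andP[t0 t1] gr.
have : t <= cutoff r.
  rewrite leNgt; apply/negP => ct; have c0 := cutoff_ge0 r.
  have h1 : g ((cutoff r + t) / 2) <= r by apply: gt_cutoff; lra.
  have h2 : g t < g ((cutoff r + t) / 2) by apply: g_decr; lra.
  by move: (lt_le_trans h2 h1); rewrite ltNge gr.
rewrite le_eqVlt => /predU1P[ct|ct].
  by exists t; split => //; rewrite /win_prob -ct ltrDl.
have [d d0 h] := Z_near r e0; have c1 := cutoff_le1 r.
pose s := Num.max (cutoff r - d / 2) t.
have ts : t <= s by rewrite le_max lexx orbT.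
have sd : cutoff r - d / 2 <= s by rewrite le_max lexx.
have sc : s < cutoff r by rewrite gt_max ct andbT gtrBl divr_gt0.
have s0 : 0 < s by exact: lt_le_trans ts.
exists s; split => //; [exact: lt_le_trans c1|by apply/ltW/lt_cutoff|].
have /h : types s by apply/interior_types; rewrite s0 (lt_le_trans sc).
rewrite gtr0_norm ?subr_gt0// => H; apply/ltr_distlCDr/H; lra.
Qed.

Context (m : R).

Local Notation win_value := (option_value n win_prob m).

Let k_cont : continuous (fun x => win_prob x ^+ n.-1).
Proof.
move=> r; apply: (cvg_comp win_prob (fun x => x ^+ n.-1)).
  exact: win_prob_continuous.
exact: exprn_continuous.
Qed.

Lemma win_prob_integrable (a b : R) :
  lebesgue_measure.-integrable `[a, b] (EFin \o (fun x => win_prob x ^+ n.-1)).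
Proof.
apply: continuous_compact_integrable; first exact: segment_compact.
exact: continuous_subspaceT.
Qed.

Lemma option_value_is_derive r : m < r -> is_derive r 1 win_value (win_prob r ^+ n.-1).
Proof.
move=> mr; have r1 : r < r + 1 by rewrite ltrDl.
have [dA A'] := continuous_FTC1_closed r1 (@win_prob_integrable m (r + 1)) mr (@k_cont r).
by split; rewrite -?derive1E.
Qed.

Lemma option_value_ndecr : {homo win_value : x y / x <= y}.
Proof.
move=> x y xy; apply: fine_le.
- by apply: integrable_fin_num => //; exact: win_prob_integrable.
- by apply: integrable_fin_num => //; exact: win_prob_integrable.
- apply: ge0_subset_integral => //=.
  + by have /integrableP[] := win_prob_integrable m y.
  + by move=> z _; rewrite lee_fin exprn_ge0// win_prob_ge0.
  + by apply: subset_itvl; rewrite bnd_simp.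
Qed.

End winning_probability.

(** * Measurability *)

Section measurability.
Context {R : realType} {d : measure_display} {T : measurableType d}.
Implicit Types (g : R -> R -> R) (w : T).

Lemma measurable_within_continuous (D : set R) (h u : _ -> R) :
  measurable D -> {within D, continuous (h : R -> R)} ->
  measurable_fun setT (u : T -> R) -> (forall w, D (u w)) ->
  measurable_fun setT (fun w => h (u w)).
Proof.
move=> mD ch mu Du; apply: (measurable_comp mD _ _ mu); first by move=> _ [w _ <-].
exact: subspace_continuous_measurable_fun.
Qed.

(* [u] is approximated by its roundings down to multiples of [1 / k.+1]. *)
Lemma measurable_within_continuous2 (D : set R) g (u v : T -> R) :
  measurable D -> {within qualities `*` D, continuous (fun p : R * R => g p.1 p.2)} ->
  measurable_fun setT u -> measurable_fun setT v ->
  (forall w, 0 <= u w) -> (forall w, D (v w)) ->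
  measurable_fun setT (fun w => g (u w) (v w)).
Proof.
move=> mD cg mu mv u0 Dv.
pose a k w : R := (Num.truncn (u w * k.+1%:R))%:R / k.+1%:R.
have a0 k w : 0 <= a k w by rewrite divr_ge0.
have aE k w : `|u w - a k w| <= k.+1%:R^-1.
  have /truncn_itv/andP[h1 h2] : 0 <= u w * k.+1%:R by rewrite mulr_ge0.
  rewrite ger0_norm; last by rewrite subr_ge0 ler_pdivrMr.
  rewrite lerBlDr -[X in X + _]mul1r -mulrDl ler_pdivlMr// nat1r; exact: ltW.
have gc c : 0 <= c -> {within D, continuous (g c)}.
  move=> c0; apply/within_continuousP => t Dt; apply/cvgrPdist_lt => e e0.
  have [x x0 h] := within_prod_dist cg ((in_qualities c).2 c0) Dt e0.
  rewrite near_withinE; apply/nbhs_ballP; exists x => //= y ty Dy.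
  by apply: h => //; [exact/in_qualities|rewrite subrr normr0].
apply: (@measurable_fun_cvg _ _ _ setT (fun k w => g (a k w) (v w))).
  move=> k _ Y mY; rewrite setTI.
  pose B j := u @^-1` `[j%:R / k.+1%:R, j.+1%:R / k.+1%:R[ `&`
    (fun w => g (j%:R / k.+1%:R) (v w)) @^-1` Y.
  rewrite (_ : _ @^-1` Y = \bigcup_j B j).
    apply: bigcupT_measurable => j; apply: measurableI; rewrite -[X in measurable X]setTI.
      by apply: mu => //; exact: measurable_itv.
    by apply: (measurable_within_continuous mD (gc _ _) mv Dv) => //; rewrite divr_ge0.
  have tE w j : (Num.truncn (u w * k.+1%:R) == j) =
      (u w \in `[j%:R / k.+1%:R, j.+1%:R / k.+1%:R[).
    by rewrite truncn_eq ?mulr_ge0// in_itv /= ler_pdivrMr// ltr_pdivlMr.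
  apply/seteqP; split => w /=.
    move=> Yw; exists (Num.truncn (u w * k.+1%:R)) => //; split; last exact: Yw.
    by rewrite /= -tE.
  by move=> [j _ [/= uj]]; rewrite -tE in uj; rewrite /a (eqP uj).
move=> w _; apply/cvgrPdist_lt => e e0.
have [x x0 h] := within_prod_dist cg ((in_qualities _).2 (u0 w)) (Dv w) e0.
near=> k; apply: h => //; [exact/in_qualities| |by rewrite subrr normr0].
apply: le_lt_trans (aE k w) _; near: k.
exact: (near_infty_natSinv_lt (PosNum x0)).
Unshelve. all: by end_near. Qed.

(** The revenue of a competing pair need not be integrable, so positive and negative parts are
    compared separately, with values in the extended reals. *)
Lemma integral_le_ae (P : probability T R) (X Y : T -> R) :
  measurable_fun setT X -> measurable_fun setT Y -> {ae P, forall w, X w <= Y w} ->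
  (\int[P]_w (X w)%:E <= \int[P]_w (Y w)%:E)%E.
Proof.
move=> mX mY XY; rewrite integralE [leRHS]integralE; apply: leeB.
- apply: ae_ge0_le_integral => //.
  + by apply: measurable_funepos; exact/measurable_EFinP.
  + by apply: measurable_funepos; exact/measurable_EFinP.
  + apply: filterS XY => w XY _; rewrite !funeposE -!EFin_max lee_fin.
    by rewrite ge_max !le_max XY lexx orbT.
- apply: ae_ge0_le_integral => //.
  + by apply: measurable_funeneg; exact/measurable_EFinP.
  + by apply: measurable_funeneg; exact/measurable_EFinP.
  + apply: filterS XY => w XY _; rewrite !funenegE -!EFin_max lee_fin.
    by rewrite ge_max !le_max lerN2 XY lexx orbT.
Qed.

End measurability.

Section measurability_on_types.
Context {R : realType}.
Implicit Types (u F f : R -> R) (C : R -> R -> R).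

Let mtypes : measurable (types : set R). Proof. exact: measurable_itv. Qed.

Let restrict_meas u : measurable_fun types u -> measurable_fun setT (u \_ types).
Proof. by move=> mu; exact/(measurable_restrictT _ mtypes). Qed.

Lemma measurable_smooth_cost k C u : smooth_cost k C -> measurable_fun types u ->
  (forall t, types t -> 0 <= u t) -> measurable_fun types (fun t => C (u t) t).
Proof.
move=> sC mu u0.
(* Outside [types] both restrictions take the value 0, which is an admissible quality and an
   admissible type. *)
have h : measurable_fun setT (fun t => C ((u \_ types) t) ((id \_ types) t)).
  apply: (measurable_within_continuous2 mtypes (smooth_cost_cont sC)).
  - exact: restrict_meas.
  - by apply: restrict_meas; exact: measurable_id.
  - by move=> t; rewrite patchE; case: ifPn => //; rewrite inE => /u0.
  - move=> t; rewrite patchE; case: ifPn; rewrite ?inE//= => _.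
    by apply/in_types; rewrite lexx ler01.
apply: (eq_measurable_fun _ _ (measurable_funTS h)) => t Tt.
by rewrite !patchE Tt.
Qed.

Lemma measurable_virtual_cost F f C u : {within types, continuous (fun t => F t / f t)} ->
  smooth_cost 3 C -> measurable_fun types u -> (forall t, types t -> 0 <= u t) ->
  measurable_fun types (fun t => virtual_cost F f C (u t) t).
Proof.
move=> hc sC mu u0; have [_ _ st] := smooth_costS sC.
apply: measurable_funD; first exact: measurable_smooth_cost sC mu u0.
apply: measurable_funM; first exact: measurable_smooth_cost st mu u0.
exact: subspace_continuous_measurable_fun.
Qed.

Lemma measurable_within_qualities (V u : R -> R) : {within qualities, continuous V} ->
  measurable_fun types u -> (forall t, types t -> 0 <= u t) ->
  measurable_fun types (fun t => V (u t)).
Proof.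
move=> cV mu u0; have mq : measurable (qualities : set R) by exact: measurable_itv.
apply: (measurable_comp mq _ _ mu) => [_ [t Tt <-]|].
  by apply/in_qualities; exact: u0.
exact: subspace_continuous_measurable_fun.
Qed.

(** The value at type 1 is arbitrary. Freezing [u] to the left of 0 and setting it to 0 from 1 on
    yields a monotone [h], the drop to 0 being monotone since [u] is nonnegative; the value at 1 is
    then restored on a single point. *)
Lemma measurable_nonincreasing_types u : (forall t, types t -> 0 <= u t) ->
  (forall s t, 0 <= s -> s <= t -> t < 1 -> u t <= u s) -> measurable_fun types u.
Proof.
move=> u0 u_nincr.
pose h t : R := if t < 1 then u (Num.max 0 t) else 0.
have mh : measurable_fun setT (fun t => - h t).
  apply: nondecreasing_measurable => // s t st; rewrite lerN2 /h.
  have [t1|t1] := ltP t 1.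
    rewrite (le_lt_trans st t1); apply: u_nincr; first by rewrite le_max lexx.
      by rewrite ge_max !le_max lexx st orbT.
    by rewrite gt_max ltr01.
  case: ifPn => // s1; apply/u0/in_types.
  by rewrite le_max lexx/= ge_max ler01 ltW.
have muh : measurable_fun types (fun t => if t == 1 then u 1 else - (- h t)).
  apply: measurable_funTS; apply: measurable_fun_ifT; last exact: measurable_funN.
    by apply: measurable_fun_eqr => //; exact: measurable_cst.
  exact: measurable_cst.
apply: (eq_measurable_fun _ _ muh) => t; rewrite inE => /in_types/andP[t0 t1].
rewrite opprK /h; case: eqVneq => [->//|tn1].
by rewrite lt_neqAle tn1 t1 (max_idPr t0).
Qed.

End measurability_on_types.

(** * The symmetric solution *)

Section first_order_solution.
Context {R : realType} (n : nat) (F f V : R -> R) (CP CI : R -> R -> R).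
Implicit Types (q r s t x : R).
Hypothesis F_density : forall x, types x ->
  (F x)%:E = (\int[lebesgue_measure]_(t in `[0%R, x]) (f t)%:E)%E.
Hypothesis F1 : F 1 = 1.
Hypothesis f_gt0 : forall t, types t -> 0 < f t.
Hypothesis f_smooth : smooth_in types 1 f.
Hypothesis V_smooth : smooth_in qualities 2 V.
Hypothesis CP_smooth : smooth_cost 3 CP.
Hypothesis CI_smooth : smooth_cost 3 CI.
Hypothesis CP_ge0 : forall q t, qualities q -> types t -> 0 <= CP q t.
Hypothesis CP_t : forall q t, 0 < q -> 0 < t < 1 -> 0 < partial_t CP q t.
Hypothesis CI_t : forall q t, 0 < q -> 0 < t < 1 -> 0 < partial_t CI q t.
Hypothesis CI_at0 : forall t, 0 < t < 1 -> CI 0 t = 0.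
Hypothesis CIq_at0 : forall t, 0 < t < 1 -> partial_q CI 0 t = 0.
Hypothesis V_incr : forall q, 0 < q -> 0 <= derive_in qualities V q.
Hypothesis V_concave : forall q, 0 < q ->
  derive_in qualities (derive_in qualities V) q <= 0.
Local Notation vP := (virtual_cost F f CP).
Local Notation vI := (virtual_cost F f CI).
Hypothesis vP_partials : forall q t, 0 < q -> t \in `]0, 1[ ->
  [/\ 0 < partial_t vP q t, 0 < partial_q (partial_q vP) q t &
      0 <= partial_t (partial_q vP) q t].
Hypothesis vI_partials : forall q t, 0 < q -> t \in `]0, 1[ ->
  [/\ 0 < partial_t vI q t, 0 < partial_q (partial_q vI) q t &
      0 <= partial_t (partial_q vI) q t].
Hypothesis V_vs_cost_at0 : forall t, types t ->
  partial_q vP 0 t < derive_in qualities V 0.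
Hypothesis V_vs_cost_large : forall t, types t -> \forall q \near +oo,
  derive_in qualities V q < partial_q vP q t + partial_q vI q t.

Local Notation dV := (derive_in qualities V).
Local Notation a := (partial_q vP).
Local Notation b := (partial_q vI).
(** The interim winning probability: all [n.-1] rivals have types above [t]. *)
Let Z t : R := (1 - F t) ^+ n.-1.

Let F0 : F 0 = 0 := cdf_at0 F_density.
Let Finc s t : 0 <= s -> s < t -> t <= 1 -> F s < F t := cdf_incr F_density f_gt0 f_smooth (s := s) (t := t).
Let r_cont := hazard_within_cont F_density f_gt0 f_smooth.
Let r_der t (t01 : 0 < t < 1) := hazard_derivable F_density f_gt0 f_smooth t01.

Let F_ge0 t : 0 <= t <= 1 -> 0 <= F t.
Proof.
move=> /andP[]; rewrite le_eqVlt => /predU1P[<-|t0] t1; first by rewrite F0.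
by rewrite -F0; exact/ltW/Finc.
Qed.

Let F_lt1 t : 0 <= t < 1 -> F t < 1.
Proof. by move=> /andP[t0 t1]; rewrite -F1 Finc. Qed.

Lemma interim_gt0 t : 0 <= t < 1 -> 0 < Z t.
Proof. by move=> t01; rewrite exprn_gt0// subr_gt0 F_lt1. Qed.

Let Z_le1 t : 0 <= t < 1 -> Z t <= 1.
Proof.
move=> t01; have [t0 t1] := andP t01; apply: exprn_ile1.
  by rewrite subr_ge0 ltW// F_lt1.
by rewrite gerBl F_ge0// t0 ltW.
Qed.

Let Z_decr s t : 0 <= s -> s < t -> t < 1 -> (1 < n)%N -> Z t < Z s.
Proof.
move=> s0 st t1 n1.
have h u : 0 <= u -> u < 1 -> 1 - F u \in Num.nneg.
  by move=> u0 u1; rewrite nnegrE subr_ge0 ltW// F_lt1// u0.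
rewrite /Z ltr_pXn2r; first by rewrite ltrD2l ltrN2 Finc// ltW.
- by rewrite -ltnS prednK// (ltn_trans _ n1).
- by apply: h => //; exact/ltW/(le_lt_trans s0).
- by apply: h => //; exact: lt_trans t1.
Qed.

Let Z_ndecr s t : 0 <= s -> s < t -> t < 1 -> Z t <= Z s.
Proof.
move=> s0 st t1; have [n1|n1] := leqP n 1; last exact/ltW/Z_decr.
by rewrite /Z; move: n1; case: (n) => [|[]].
Qed.

Let V_deriv q : qualities q -> derivable_in qualities V q.
Proof. by case: V_smooth => _ [h _] /h. Qed.

Let V_cont : {within qualities, continuous V}. Proof. by case: V_smooth. Qed.

Let dV_cont : {within qualities, continuous dV}. Proof. by case: V_smooth => _ [_ []]. Qed.

Let V_ndecr q q' : 0 <= q -> q <= q' -> V q <= V q'.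
Proof.
move=> q0 qq; apply: (@derive_in_ndecr _ qualities V) => //; first exact: sub_qualities.
  by apply: continuous_subspaceW V_cont; exact: sub_qualities.
move=> x /andP[qx _]; have x0 := le_lt_trans q0 qx.
by split; [exact/V_deriv/in_qualities/ltW|exact: V_incr].
Qed.

Let dV_nincr q q' : 0 <= q -> q <= q' -> dV q' <= dV q.
Proof.
move=> q0 qq; rewrite -lerN2.
apply: (@is_derive_ndecr _ (fun x => - dV x) (fun x => - derive_in qualities dV x)) => //.
  apply/within_continuousP => x xq; apply: cvgN.
  by have /within_continuousP := continuous_subspaceW (@sub_qualities _ q q' q0) dV_cont; exact.
move=> x /andP[qx _]; have x0 := le_lt_trans q0 qx; split; last by rewrite oppr_ge0 V_concave.
apply: is_deriveN; apply: is_derive_in; first exact: qualities_interior.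
by case: V_smooth => _ [_ [_ [h _]]]; apply: h; exact/in_qualities/ltW.
Qed.

Let Q0 : qualities (0 : R). Proof. exact/in_qualities. Qed.

(** Besides [partial_q CI], the marginal virtual cost contains the mixed derivative weighted by
    [F / f]. At interior types the mixed derivative vanishes; at type 0 the weight does. *)
Lemma virtual_investment_partial_q_at0 t : 0 <= t < 1 -> b 0 t = 0.
Proof.
move=> /andP[t0 t1]; have Tt : types t by apply/in_types; rewrite t0 ltW.
rewrite (virtual_cost_partial_q F f CI_smooth Q0 Tt).2.
move: t0; rewrite le_eqVlt => /predU1P[<-|t0].
  by rewrite F0 mul0r mulr0 addr0 (partial_q_at00 CI_smooth CIq_at0).
have t01 : 0 < t < 1 by rewrite t0.
by rewrite CIq_at0// (partial_qt_at0 CI_smooth CI_t CI_at0 CIq_at0 t01) mul0r addr0.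
Qed.

Let a_incr q q' t := virtual_cost_q_incr CP_smooth vP_partials (q := q) (q' := q') (t := t).
Let b_incr q q' t := virtual_cost_q_incr CI_smooth vI_partials (q := q) (q' := q') (t := t).
Let a_t q s t := virtual_cost_q_t_ndecr r_cont r_der CP_smooth vP_partials (q := q) (s := s) (t := t).
Let b_t q s t := virtual_cost_q_t_ndecr r_cont r_der CI_smooth vI_partials (q := q) (s := s) (t := t).

Let b_gt0 q t : 0 < q -> 0 < t < 1 -> 0 < b q t.
Proof.
move=> q0 t01; have [t0 t1] := andP t01.
by rewrite -(@virtual_investment_partial_q_at0 t) ?t1 ?ltW// b_incr.
Qed.

(** The intermediate value theorem applies to the difference of the two sides. It is positive at
    quality 0, where the marginal investment cost vanishes, and negative at a large quality, because
    dividing by [Z t <= 1] can only raise that cost. *)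
Lemma first_order_solvable t : 0 <= t < 1 ->
  exists2 q, 0 <= q & dV q = a q t + b q t / Z t.
Proof.
move=> t01; have [t0 t1] := andP t01; have Tt : types t by apply/in_types; rewrite t0 ltW.
have [x [x0 dx]] : exists x, 0 < x /\ dV x < a x t + b x t.
  have h0 : \forall x \near +oo, 0 < x :> R by exact: nbhs_pinfty_gt.
  by have [x [? ?]] := filter_ex (filterI h0 (V_vs_cost_large Tt)); exists x.
have Zt := interim_gt0 t01.
have bx : b x t <= b x t / Z t.
  move: (t0); rewrite le_eqVlt => /predU1P[t00|t0'].
    by rewrite /Z -t00 F0 subr0 expr1n divr1.
  by rewrite ler_pdivlMr// ger_pMr ?Z_le1// b_gt0// t0'.
pose g q := dV q - a q t - b q t / Z t.
have gc : {within `[0, x], continuous g}.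
  apply/within_continuousP => y yx.
  have sub := @sub_qualities _ 0 x (lexx 0).
  apply: cvgB; first apply: cvgB.
  - by have /within_continuousP := continuous_subspaceW sub dV_cont; exact.
  - have := continuous_subspaceW sub (virtual_cost_q_cont_q (F := F) (f := f) CP_smooth Tt).
    by move/within_continuousP; exact.
  - apply: cvgM; last exact: cvg_cst.
    have := continuous_subspaceW sub (virtual_cost_q_cont_q (F := F) (f := f) CI_smooth Tt).
    by move/within_continuousP; exact.
have g0 : 0 < g 0.
  by rewrite /g virtual_investment_partial_q_at0// mul0r subr0 subr_gt0 V_vs_cost_at0.
have gx : g x < 0 by rewrite /g; lra.
have [|q] := IVT (ltW x0) gc (v := 0); first by rewrite ge_min le_max (ltW g0) (ltW gx) orbT.
rewrite in_itv /= => /andP[q0 _] gq; exists q => //.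
by rewrite addrC -(subr0_eq gq) subrK.
Qed.

Context (qs : R -> R).
Hypothesis qs_ge0 : forall t, types t -> 0 <= qs t.
Hypothesis foc : forall t, 0 <= t < 1 -> dV (qs t) = a (qs t) t + b (qs t) t / Z t.

Lemma solution_gt0 t : 0 <= t < 1 -> 0 < qs t.
Proof.
move=> t01; have [t0 t1] := andP t01; have Tt : types t by apply/in_types; rewrite t0 ltW.
have := qs_ge0 Tt; rewrite le_eqVlt => /predU1P[q0|//].
have := V_vs_cost_at0 Tt; have := foc t01.
by rewrite -q0 virtual_investment_partial_q_at0// mul0r addr0 => ->; rewrite !ltxx.
Qed.

(** If a higher type chose a higher quality, the marginal value would weakly fall while the marginal
    cost strictly rose: [a] and [b] grow with quality and type, and the divisor [Z] shrinks with the
    type. *)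
Lemma solution_nincr s t : 0 <= s -> s <= t -> t < 1 -> qs t <= qs s.
Proof.
move=> s0; rewrite le_eqVlt => /predU1P[->//|st] t1.
have t01 : 0 < t < 1 by rewrite t1 (le_lt_trans s0).
have s01 : 0 <= s < 1 by rewrite s0 (lt_trans st).
have t01' : 0 <= t < 1 by rewrite t1 (le_trans s0)// ltW.
have qs0 := solution_gt0 s01.
rewrite leNgt; apply/negP => qq.
have h1 := dV_nincr (ltW qs0) (ltW qq); rewrite (foc s01) (foc t01') in h1.
(* Strict growth in the quality is available at interior types only and [s] may be 0, so the quality
   is varied at type [t] and the type at quality [qs s]. *)
have h2 := a_incr (ltW qs0) qq t01; have h3 := b_incr (ltW qs0) qq t01.
have h4 := a_t qs0 s0 (ltW st) (ltW t1); have h5 := b_t qs0 s0 (ltW st) (ltW t1).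
have h6 : b (qs s) s / Z s <= b (qs s) t / Z t.
  apply: (@le_trans _ _ (b (qs s) t / Z s)); first by rewrite ler_pM2r// invr_gt0 interim_gt0.
  by rewrite ler_pM2l ?b_gt0// lef_pV2 ?posrE ?interim_gt0// Z_ndecr.
have h7 : b (qs s) t / Z t <= b (qs t) t / Z t.
  by apply: ler_wpM2r (ltW h3); rewrite invr_ge0; exact/ltW/interim_gt0.
suff : a (qs s) s + b (qs s) s / Z s < a (qs t) t + b (qs t) t / Z t by rewrite ltNge h1.
exact: ltr_leD (le_lt_trans h4 h2) (le_trans h6 h7).
Qed.

(** With at least two firms [Z] is strictly decreasing. Equal qualities at two types would give
    equal marginal values but, as [b] is positive, different marginal costs. *)
Lemma solution_decr s t : (1 < n)%N -> 0 <= s -> s < t -> t < 1 -> qs t < qs s.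
Proof.
move=> n1 s0 st t1.
have t01 : 0 < t < 1 by rewrite t1 (le_lt_trans s0).
have s01 : 0 <= s < 1 by rewrite s0 (lt_trans st).
have t01' : 0 <= t < 1 by rewrite t1 (le_trans s0)// ltW.
have qs0 := solution_gt0 s01.
rewrite lt_neqAle (solution_nincr s0 (ltW st) t1) andbT; apply/eqP => qq.
have h4 := a_t qs0 s0 (ltW st) (ltW t1); have h5 := b_t qs0 s0 (ltW st) (ltW t1).
have h6 : b (qs s) s / Z s < b (qs s) t / Z t.
  apply: (@le_lt_trans _ _ (b (qs s) t / Z s)); first by rewrite ler_pM2r// invr_gt0 interim_gt0.
  by rewrite ltr_pM2l ?b_gt0// ltf_pV2 ?posrE ?interim_gt0// Z_decr.
have := foc t01'; rewrite qq (foc s01) => /eqP.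
by rewrite lt_eqF//; exact: ler_ltD h4 h6.
Qed.

Definition quality_surplus q t : R := V q - vP q t.
Local Notation W := quality_surplus.
Local Notation sc := (score W qs).
Local Notation K := (win_prob F sc).

Let W_cont t : 0 < t < 1 -> {within qualities, continuous (W ^~ t)}.
Proof.
move=> t01; apply/within_continuousP => x Qx; apply: cvgB.
  by have /within_continuousP := V_cont; exact.
by have /within_continuousP := virtual_cost_cont_q (F := F) (f := f) CP_smooth (interior_types t01); exact.
Qed.

Let c_cont t : 0 < t < 1 -> {within qualities, continuous (vI ^~ t)}.
Proof. by move=> t01; exact: (virtual_cost_cont_q (F := F) (f := f) CI_smooth (interior_types t01)). Qed.

Let W_der q t : 0 < q -> 0 < t < 1 -> is_derive q 1 (W ^~ t) (dV q - a q t).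
Proof.
move=> q0 t01; apply: is_deriveB; last exact: virtual_cost_is_derive (interior_types t01).
by apply: is_derive_in; [exact: qualities_interior|exact/V_deriv/in_qualities/ltW].
Qed.

Let c_der q t : 0 < q -> 0 < t < 1 -> is_derive q 1 (vI ^~ t) (b q t).
Proof. by move=> q0 t01; exact: virtual_cost_is_derive (interior_types t01). Qed.

Let dW_q q q' t : 0 <= q -> q <= q' -> 0 < t < 1 -> dV q' - a q' t <= dV q - a q t.
Proof.
move=> q0 + t01; rewrite le_eqVlt => /predU1P[->//|qq].
by apply: lerB; [exact/dV_nincr/ltW|exact/ltW/a_incr].
Qed.

Let dW_t q s t : 0 < q -> 0 < s -> s <= t -> t < 1 -> dV q - a q t <= dV q - a q s.
Proof. by move=> q0 s0 st t1; rewrite lerD2l lerN2 a_t// ltW. Qed.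

Let dc_t q s t : 0 < q -> 0 < s -> s <= t -> t < 1 -> b q s <= b q t.
Proof. by move=> q0 s0 st t1; rewrite b_t// ltW. Qed.

Let dc_0 t : 0 < t < 1 -> b 0 t = 0.
Proof. by move=> /andP[t0 t1]; rewrite virtual_investment_partial_q_at0// t1 ltW. Qed.

Let W_t q s t : 0 < q -> 0 < s -> s < t -> t < 1 -> W q t < W q s.
Proof.
move=> q0 s0 st t1; rewrite ltrD2l ltrN2.
by apply: (virtual_cost_t_incr r_cont r_der CP_smooth vP_partials) => //; exact: ltW.
Qed.

Let co t : 0 < t < 1 -> 0 <= t < 1. Proof. by move=> /andP[/ltW-> ->]. Qed.

Let Z_gt0 t : 0 < t < 1 -> 0 < Z t. Proof. by move/co/interim_gt0. Qed.

Let q_gt0 t : 0 < t < 1 -> 0 < qs t. Proof. by move/co/solution_gt0. Qed.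

Let q_anti s t : 0 < s -> s < t -> t < 1 -> qs t <= qs s.
Proof. by move=> s0 st t1; apply: solution_nincr => //; exact: ltW. Qed.

Let focW t : 0 < t < 1 -> Z t * (dV (qs t) - a (qs t) t) = b (qs t) t.
Proof.
move=> t01; rewrite foc ?co// addrAC subrr add0r mulrCA divff ?mulr1//.
by rewrite gt_eqF// Z_gt0.
Qed.

Lemma solution_score_decr s t : 0 < s -> s < t -> t < 1 -> sc t < sc s.
Proof. exact: (score_decr W_cont W_der dW_q b_incr dc_0 W_t Z_gt0 q_gt0 q_anti focW). Qed.

Let score_ge t : 0 < t < 1 -> W 0 t < sc t.
Proof.
move=> t01.
by apply: (W_incr W_cont W_der dW_q b_incr dc_0 Z_gt0 q_gt0 focW) => //; exact: q_gt0.
Qed.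

Lemma virtual_cost_ge0 C q t : (forall q t, qualities q -> types t -> 0 <= C q t) ->
  (forall q t, 0 < q -> 0 < t < 1 -> 0 < partial_t C q t) ->
  0 < q -> 0 < t < 1 -> 0 <= virtual_cost F f C q t.
Proof.
move=> C0 Ct q0 t01; have Tt := interior_types t01.
apply: addr_ge0; first by apply: C0 => //; exact/in_qualities/ltW.
apply: mulr_ge0; first exact/ltW/Ct.
by apply: divr_ge0; [apply/F_ge0/in_types|exact/ltW/f_gt0].
Qed.

(** An upper bound for the scores of the solution: the nonnegative virtual production cost is
    dropped, and the quality of type 0 is the largest one. *)
Definition score_upper : R := V (qs 0).

Lemma solution_score_le t : 0 < t < 1 -> sc t <= score_upper.
Proof.
move=> t01; have [t0 t1] := andP t01; apply: (@le_trans _ _ (V (qs t))).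
  by rewrite gerBl virtual_cost_ge0// q_gt0.
by apply: V_ndecr; [exact/ltW/q_gt0|apply: solution_nincr => //; exact: ltW].
Qed.

(** [vP 0] attains a maximum on the compact type interval. The slack 1 keeps [m] strictly below the
    scores, which is where [A] is known to be differentiable. *)
Lemma score_lower_ex : exists m, forall t, 0 < t < 1 -> m < W 0 t.
Proof.
have [c c01 vc] := EVT_max ler01 (virtual_cost_cont_t r_cont CP_smooth Q0).
exists (V 0 - vP 0 c - 1) => t t01; apply: (@lt_le_trans _ _ (V 0 - vP 0 c)).
  by rewrite gtrBl.
by rewrite lerD2l lerN2; apply: vc; move: (interior_types t01).
Qed.

Let F_cont := cdf_within_cont F_density f_smooth.

Lemma solution_win_prob_ge0 r : 0 <= K r.
Proof. by apply: win_prob_ge0. Qed.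

Context (m : R).
Hypothesis m_lt : forall t, 0 < t < 1 -> m < W 0 t.

Local Notation A := (option_value n K m).

Lemma solution_score_gt t : 0 < t < 1 -> m < sc t.
Proof. by move=> t01; apply: lt_trans (m_lt t01) (score_ge t01). Qed.

Lemma score_bounds : m < score_upper.
Proof.
have h : 0 < (1 / 2 : R) < 1 by apply/andP; split; lra.
exact: lt_le_trans (solution_score_gt h) (solution_score_le h).
Qed.

Lemma solution_value_is_derive r : m < r -> is_derive r 1 A (K r ^+ n.-1).
Proof.
by move=> mr; apply: (option_value_is_derive n F_cont solution_score_decr).
Qed.

Lemma solution_net_value_le q t : 0 < t < 1 -> 0 <= q ->
  A (W q t) - vI q t <= A (sc t) - vI (qs t) t.
Proof.
have k0 r : 0 <= K r ^+ n.-1 by rewrite exprn_ge0// solution_win_prob_ge0.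
have kl := win_prob_left n F_cont solution_score_decr.
have kr := win_prob_right n F_cont solution_score_decr.
have Am : {homo A : x y / x <= y}.
  by apply: option_value_ndecr => //; exact: solution_score_decr.
exact: (net_value_le W_cont c_cont W_der c_der dW_q dW_t b_incr dc_t dc_0 W_t Z_gt0
  q_gt0 focW k0 kl kr solution_value_is_derive Am m_lt).
Qed.

(* Above every score of the solution a unit of score wins for sure. *)
Lemma solution_value_above r : score_upper <= r -> A score_upper + (r - score_upper) <= A r.
Proof.
move=> Ur; suff : A score_upper - score_upper <= A r - r by lra.
apply: (@is_derive_ndecr _ (fun r => A r - r) (fun r => K r ^+ n.-1 - 1)) => //.
  apply/within_continuousP => x; rewrite /= in_itv /= => /andP[Ux _].
  apply: cvgB; last exact: cvg_within.
  apply: cvg_within_filter.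
  have [dA _] := solution_value_is_derive (lt_le_trans score_bounds Ux).
  exact/differentiable_continuous/derivable1_diffP.
move=> x /andP[Ux _]; split.
  by apply: is_deriveB; apply: solution_value_is_derive; exact: lt_trans score_bounds Ux.
suff -> : K x = 1 by rewrite expr1n subrr.
suff c0 : cutoff sc x = 0 by rewrite /win_prob c0 F0 subr0.
apply/eqP; rewrite eq_le cutoff_ge0 andbT leNgt; apply/negP => c0.
have [c1 c2] := (cutoff_le1 sc x, cutoff_ge0 sc x).
(* Half of a positive cutoff is an interior type whose score exceeds [x], hence also
   [score_upper]. *)
have h : 0 < cutoff sc x / 2 < 1 by apply/andP; split; lra.
have := @lt_cutoff _ sc solution_score_decr x (cutoff sc x / 2).
have := solution_score_le h; move=> h1 h2.
have /lt_le_trans/(_ h1) : x < sc (cutoff sc x / 2) by apply: h2; lra.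
by rewrite ltNge ltW.
Qed.

Lemma virtual_investment_at0 t : 0 < t < 1 -> vI 0 t = 0.
Proof.
by move=> t01; rewrite /virtual_cost CI_at0// (partial_t_at0 CI_at0 t01) mul0r addr0.
Qed.

End first_order_solution.

(** * From pointwise bounds to the optimality of the solution *)

Section optimality.
Context {R : realType} {d : measure_display} {T : measurableType d}.
Context (P : probability T R) (n : nat) (theta : 'I_n -> {RV P >-> R}).
Context (F V : R -> R) (vP vI : R -> R -> R) (qs : R -> R) (m M L : R).
Implicit Types (i j : 'I_n) (q r x : R) (t : R) (u : R -> R) (w : T).
Hypothesis n_gt0 : (0 < n)%N.
Hypothesis theta_types : forall i w, types (theta i w).
Hypothesis theta_indep : mutually_independent theta.
Hypothesis theta_cdf : forall i x, cdf (theta i) x = (F x)%:E.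
Hypothesis F0 : F 0 = 0.
Hypothesis F1 : F 1 = 1.
Hypothesis F_lip : forall s t, 0 <= s -> s <= t -> t <= 1 -> F t - F s <= L * (t - s).

Let W q t : R := V q - vP q t.
Let sc : R -> R := score W qs.
Let K : R -> R := win_prob F sc.
Let A : R -> R := option_value n K m.

Hypothesis V_meas : forall u, measurable_fun types u -> (forall t, types t -> 0 <= u t) ->
  measurable_fun types (fun t => V (u t)).
Hypothesis vP_meas : forall u, measurable_fun types u -> (forall t, types t -> 0 <= u t) ->
  measurable_fun types (fun t => vP (u t) t).
Hypothesis vI_meas : forall u, measurable_fun types u -> (forall t, types t -> 0 <= u t) ->
  measurable_fun types (fun t => vI (u t) t).
Hypothesis qs_meas : measurable_fun types qs.
Hypothesis qs_ge0 : forall t, types t -> 0 <= qs t.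
Hypothesis sc_decr : forall s t, 0 < s -> s < t -> t < 1 -> sc t < sc s.
Hypothesis sc_ge : forall t, 0 < t < 1 -> m <= sc t.
Hypothesis sc_le : forall t, 0 < t < 1 -> sc t <= M.
Hypothesis mM : m <= M.
Hypothesis K_cont : continuous K.
Hypothesis K_ge0 : forall r, 0 <= K r.
Hypothesis K_le1 : forall r, K r <= 1.
Hypothesis A_ndecr : {homo A : x y / x <= y}.
Hypothesis A_above : forall r, M <= r -> A M + (r - M) <= A r.
Hypothesis net_value : forall q t, 0 < t < 1 -> 0 <= q ->
  A (W q t) - vI q t <= A (sc t) - vI (qs t) t.
Hypothesis vI_at0 : forall t, 0 < t < 1 -> vI 0 t = 0.
Hypothesis vI_qs_ge0 : forall t, 0 < t < 1 -> 0 <= vI (qs t) t.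

(** Scores and net values are controlled at interior types only. A default [c] inside the required
    range extends the bounds to all of [R], and on types it changes the function only at 0 and 1. *)
Definition on_interior (h : R -> R) (c t : R) : R := if (0 < t) && (t < 1) then h t else c.

Lemma measurable_on_interior h c : measurable_fun types h ->
  measurable_fun setT (on_interior h c).
Proof.
move=> mh; have mT : measurable (types : set R) by exact: measurable_itv.
rewrite (_ : on_interior h c = on_interior (h \_ types) c).
  apply: measurable_fun_ifT; last exact: measurable_cst.
    by apply: measurable_and; apply: measurable_fun_ltr => //; exact: measurable_cst.
  exact/(measurable_restrictT _ mT).
apply/funext => t; rewrite /on_interior; case: ifPn => // t01.
by rewrite patchE mem_set//; exact: interior_types.
Qed.

Let law i j := identically_distributed theta_cdf i j.
Let aew := ae_distinct_interior theta_types theta_indep theta_cdf F0 F1 F_lip.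

Let sopt := on_interior sc m.

Let mW u : measurable_fun types u -> (forall t, types t -> 0 <= u t) ->
  measurable_fun types (fun t => W (u t) t).
Proof. by move=> mu u0; apply: measurable_funB; [exact: V_meas|exact: vP_meas]. Qed.

Let msopt : measurable_fun setT sopt.
Proof. by apply: measurable_on_interior; exact: mW. Qed.

Let sopt_bounds t : m <= sopt t <= M.
Proof.
rewrite /sopt /on_interior; case: ifPn => t01; last by rewrite lexx.
by rewrite sc_ge// sc_le.
Qed.

Let mtheta i (B : set R) : measurable B -> measurable (theta i @^-1` B).
Proof. by move=> mB; exact: measurable_funPTI. Qed.

(** Apart from the null types 0 and [c], a score is at most [r] exactly when the type exceeds the
    cutoff; at type 1 the default [m] is at most [r] as well. *)
Lemma score_law i r : m <= r <= M -> P [set w | sopt (theta i w) <= r] = (K r)%:E.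
Proof.
move=> /andP[mr rM]; set B := [set w | _]; set c := cutoff sc r.
have mB : measurable B.
  apply: (mtheta i (B := [set x | sopt x <= r])).
  by rewrite -[X in measurable X]setTI; exact: (measurable_fun_le measurableT msopt (measurable_cst r)).
have PC : P (theta i @^-1` `]c, +oo[) = (K r)%:E by exact: prob_gt.
have mC : measurable (theta i @^-1` `]c, +oo[) by exact: (mtheta i (measurable_itv _)).
have point x : types x -> P (theta i @^-1` [set x]) = 0%E.
  by move=> Tx; exact: (prob_point theta_cdf F0 F1 F_lip i Tx).
have m1 x : measurable (theta i @^-1` [set x]) by exact: (mtheta i (measurable_set1 _)).
have Tc : types c by exact: cutoff_types.
have T0 : types (0 : R) by apply/in_types; rewrite lexx ler01.
apply/eqP; rewrite eq_le; apply/andP; split; rewrite -PC; last first.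
  apply: le_measure; rewrite ?inE//.
  move=> w /=; rewrite in_itv /= andbT => cw; rewrite /B /= /sopt /on_interior.
  by case: ifPn => // /andP[_ w1]; exact: gt_cutoff.
apply: (@le_trans _ _ (P (theta i @^-1` `]c, +oo[ `|`
    (theta i @^-1` [set c] `|` theta i @^-1` [set 0%R])))).
  apply: le_measure; rewrite ?inE//.
    by apply: measurableU => //; apply: measurableU.
  move=> w /=; rewrite /B /= in_itv /= andbT /sopt /on_interior => sr.
  have /in_types/andP[w0 w1] := theta_types i w.
  have [cw|wc|->] := ltgtP c (theta i w); [by left| |by right; left].
  right; right; apply/eqP; rewrite eq_le w0 andbT leNgt; apply/negP => w0'.
  have w1' : theta i w < 1 by apply: lt_le_trans wc _; exact: cutoff_le1.
  by move: sr; rewrite w0' w1' /= leNgt => /negP; apply; exact: lt_cutoff.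
apply: le_trans (measureU2 _ _ _) _ => //; first exact: measurableU.
rewrite -[leRHS]adde0; apply: leeD => //.
apply: le_trans (measureU2 _ _ _) _ => //.
have -> : (0 : \bar R)%E = (0 + 0)%E by rewrite adde0.
by apply: leeD; rewrite le_eqVlt; apply/orP; left; apply/eqP; exact: point.
Qed.

(** By [net_value] this is the largest net value [A (W q t) - vI q t] over all qualities, attained
    at [qs t]. *)
Let phi := on_interior (fun t => A (sc t) - vI (qs t) t) 0.

Let A_ge0 r : 0 <= A r. Proof. exact: (option_value_ge0 n m K_ge0). Qed.

Let A_le r : r <= M -> A r <= M - m.
Proof. exact: (option_value_le n K_cont K_ge0 K_le1 mM). Qed.

Let A_at_m : A m = 0.
Proof. by rewrite /A /option_value set_itv1 Rintegral_set1. Qed.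

Let A_meas : measurable_fun setT A.
Proof. exact: nondecreasing_measurable. Qed.

Let mphi : measurable_fun setT phi.
Proof.
apply: measurable_on_interior; apply: measurable_funB; last exact: vI_meas.
by apply: (measurableT_comp A_meas); exact: mW.
Qed.

(** The lower bound compares with quality 0, whose virtual investment cost is 0. Boundedness of
    [phi] gives the integrability needed to split expectations. *)
Let phi_bounds t : 0 <= phi t <= M - m.
Proof.
rewrite /phi /on_interior; case: ifPn => t01; last by rewrite lexx subr_ge0.
apply/andP; split.
  apply: le_trans (net_value t01 (lexx 0)); rewrite vI_at0// subr0; exact: A_ge0.
apply: le_trans (A_le (sc_le t01)); rewrite gerBl; exact: vI_qs_ge0.
Qed.

Let loss s w := score_loss theta K m M s w.

(** The constant [M] cancels the one inside the loss, leaving the top score plus the sum of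
    [phi (theta i w) - A (s (theta i w))]. *)
Let bound s w := M + \sum_(i < n) phi (theta i w) - loss s w.

(** Truncating the scores is harmless. A score below [m] is raised to [m], where [A] is still 0. An
    excess over [M] adds at most itself to the revenue, since [z i <= 1], and at least as much to
    [A], whose slope above [M] is 1. *)
Lemma revenue_le u w (z : 'I_n -> R) : (forall t, types t -> 0 <= u t) ->
  (forall i, 0 < theta i w < 1) -> (forall i, 0 <= z i) -> \sum_(i < n) z i = 1 ->
  \sum_(i < n) (V (u (theta i w)) * z i - vP (u (theta i w)) (theta i w) * z i
                - vI (u (theta i w)) (theta i w)) <=
  bound (on_interior (fun t => Num.max m (Num.min (W (u t) t) M)) m) w.
Proof.
move=> u0 w01 z0 z1; set s := on_interior _ m.
rewrite /bound /loss /score_loss.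
pose x i := W (u (theta i w)) (theta i w).
(* The excess over [M], which enters the bound on revenue and the bound on investment and cancels
   between them. *)
pose e i := Num.max 0 (x i - M).
have sE i : s (theta i w) = Num.max m (Num.min (x i) M) by rewrite /s /on_interior w01.
have phiE i : phi (theta i w) = A (sc (theta i w)) - vI (qs (theta i w)) (theta i w).
  by rewrite /phi /on_interior w01.
have xs i : x i <= s (theta i w) + e i.
  rewrite sE /e; case: (leP (x i) M) => xM.
    by apply: (@le_trans _ _ (x i + 0)); [rewrite addr0|rewrite lerD// le_max ?lexx ?orbT].
  have -> : Num.max m M = M by apply/max_idPr.
  have : x i - M <= Num.max 0 (x i - M) by rewrite le_max lexx orbT.
  lra.
have xA i : A (s (theta i w)) + e i <= A (x i).
  rewrite sE /e; case: (leP (x i) M) => xM.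
    have -> : Num.max 0 (x i - M) = 0 by apply/max_idPl; rewrite subr_le0.
    rewrite addr0; case: (leP m (x i)) => // xm.
    by rewrite A_at_m.
  have -> : Num.max m M = M by apply/max_idPr.
  have -> : Num.max 0 (x i - M) = x i - M by apply/max_idPr; rewrite subr_ge0 ltW.
  exact/A_above/ltW.
have e0 i : 0 <= e i by rewrite /e le_max lexx.
have zle i : z i <= 1.
  by rewrite -z1 (bigD1 i)//= lerDl sumr_ge0.
have step1 : \sum_(i < n) x i * z i <= top_score theta m s w + \sum_(i < n) e i.
  apply: (@le_trans _ _ (\sum_(i < n) (top_score theta m s w * z i + e i))).
    apply: ler_sum => i _; apply: (@le_trans _ _ ((s (theta i w) + e i) * z i)).
      by rewrite ler_wpM2r.
    rewrite mulrDl lerD//; first by rewrite ler_wpM2r// le_top_score.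
    by rewrite ler_piMr.
  by rewrite big_split/= -mulr_sumr z1 mulr1.
have step2 : \sum_(i < n) (A (s (theta i w)) + e i - phi (theta i w)) <=
    \sum_(i < n) vI (u (theta i w)) (theta i w).
  apply: ler_sum => i _; have := net_value (w01 i) (u0 _ (theta_types i w)).
  rewrite phiE; have := xA i; rewrite /x; lra.
rewrite sumrB (eq_bigr (fun i => x i * z i)); last by move=> i _; rewrite /x /W mulrBl.
move: step2; rewrite sumrB big_split/=.
have -> : \sum_(i < n) option_value n K m (s (theta i w)) = \sum_(i < n) A (s (theta i w)) by [].
move: step1; lra.
Qed.

Lemma lowest_type_wins w : (forall i, 0 < theta i w < 1) ->
  (forall i j, i != j -> theta i w <> theta j w) ->
  exists i0, (forall i, theta i0 w <= theta i w) /\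
    forall i, z_sym i (profile theta w) = (i == i0)%:R :> R.
Proof.
move=> w01 wd; pose i0 := [arg min_(i < Ordinal n_gt0) theta i w]%O.
have i0le i : theta i0 w <= theta i w.
  by rewrite /i0; case: arg_minP => //= j _; apply.
exists i0; split => // i; rewrite /z_sym tnth_mktuple.
have -> : lowest_type (profile theta w) = theta i0 w.
  rewrite /lowest_type; apply/eqP; rewrite eq_le; apply/andP; split.
    by rewrite (bigminD1 i0)//= ge_min tnth_mktuple lexx.
  apply/bigmin_geP; split; first by case/andP: (w01 i0) => _ /ltW.
  by move=> j _; rewrite tnth_mktuple.
by have [->|/wd/eqP/negbTE->] := eqVneq i i0; rewrite ?eqxx.
Qed.

Lemma z_sym_sum w : (forall i, 0 < theta i w < 1) ->
  (forall i j, i != j -> theta i w <> theta j w) ->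
  \sum_(i < n) z_sym i (profile theta w) = 1 :> R.
Proof.
move=> w01 wd; have [i0 [_ zE]] := lowest_type_wins w01 wd.
rewrite (bigD1 i0)//= zE eqxx big1 ?addr0// => i /negbTE ii0.
by rewrite zE ii0.
Qed.

(** The estimates of [revenue_le] are tight at the solution: its scores already lie in [[m, M]], its
    net values are those in [phi], and the winner, having the lowest type, has the top score. *)
Lemma bound_le_revenue w : (forall i, 0 < theta i w < 1) ->
  (forall i j, i != j -> theta i w <> theta j w) ->
  bound sopt w <= \sum_(i < n) (V (qs (theta i w)) * z_sym i (profile theta w)
     - vP (qs (theta i w)) (theta i w) * z_sym i (profile theta w)
     - vI (qs (theta i w)) (theta i w)).
Proof.
move=> w01 wd.
have phiE i : phi (theta i w) = A (sc (theta i w)) - vI (qs (theta i w)) (theta i w).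
  by rewrite /phi /on_interior w01.
have sE i : sopt (theta i w) = sc (theta i w) by rewrite /sopt /on_interior w01.
have [i0 [i0le zE]] := lowest_type_wins w01 wd.
rewrite sumrB (eq_bigr (fun i => sc (theta i w) * z_sym i (profile theta w))); last first.
  by move=> i _; rewrite -mulrBl.
have -> : \sum_(i < n) sc (theta i w) * z_sym i (profile theta w) = sc (theta i0 w).
  rewrite (bigD1 i0)//= zE eqxx mulr1 big1 ?addr0// => i /negbTE ii0.
  by rewrite zE ii0 mulr0.
have top : top_score theta m sopt w <= sc (theta i0 w).
  rewrite top_score_le sc_ge//=; apply/forallP => i; rewrite sE.
  have := i0le i; rewrite le_eqVlt => /predU1P[->//|lt0].
  by case/andP: (w01 i0) => ? _; case/andP: (w01 i) => _ ?; exact/ltW/sc_decr.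
rewrite /bound /loss /score_loss.
have -> : \sum_(i < n) option_value n K m (sopt (theta i w)) = \sum_(i < n) A (sc (theta i w)).
  by apply: eq_bigr => i _; rewrite sE.
rewrite (eq_bigr _ (fun i _ => phiE i)) sumrB; lra.
Qed.

Let mbound (s : R -> R) : measurable_fun setT s -> (forall x, s x <= M) -> measurable_fun setT (bound s).
Proof.
move=> ms sM; apply: measurable_funB; last exact: (measurable_score_loss theta K_cont K_ge0 mM ms sM).
apply: measurable_funD; first exact: measurable_cst.
by apply: measurable_sum => i; exact: (measurableT_comp mphi).
Qed.

Let bounded_integrable (X : T -> R) (c : R) : measurable_fun setT X ->
  (forall w, `|X w| <= c) -> P.-integrable setT (EFin \o X).
Proof.
move=> mX Xc; apply: measurable_bounded_integrable => //.
  by apply: (@le_lt_trans _ _ 1%E); [exact: probability_le1|rewrite ltry].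
exists c; split; first exact: num_real.
by move=> y cy w _; apply: le_trans (Xc w) _; exact: ltW.
Qed.

(** The part [G] is common to both sides and everything is bounded, so the comparison reduces to the
    expected losses. *)
Lemma expected_bound_le (s : R -> R) : measurable_fun setT s -> (forall x, m <= s x <= M) ->
  (\int[P]_w (bound s w)%:E <= \int[P]_w (bound sopt w)%:E)%E.
Proof.
move=> ms sb.
pose G w := M + \sum_(i < n) phi (theta i w).
have mG : measurable_fun setT G.
  apply: measurable_funD; first exact: measurable_cst.
  by apply: measurable_sum => i; exact: (measurableT_comp mphi).
have iG : P.-integrable setT (EFin \o G).
  apply: (bounded_integrable (c := `|M| + (M - m) *+ n)) => // w.
  apply: le_trans (ler_normD _ _) _; rewrite lerD2l ger0_norm; last first.
    by apply: sumr_ge0 => i _; case/andP: (phi_bounds (theta i w)).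
  rewrite -[X in _ *+ X]card_ord -sumr_const; apply: ler_sum => i _.
  by case/andP: (phi_bounds (theta i w)).
have boundE (s' : R -> R) : measurable_fun setT s' -> (forall x, m <= s' x <= M) ->
    (\int[P]_w (bound s' w)%:E = \int[P]_w (G w)%:E - \int[P]_w (loss s' w)%:E)%E.
  move=> ms' sb'; have sM x : s' x <= M by case/andP: (sb' x).
  have il : P.-integrable setT (EFin \o loss s').
    apply: (bounded_integrable (c := (M - m) *+ n.+1)).
      exact: (measurable_score_loss theta K_cont K_ge0 mM ms' sM).
    move=> w; rewrite ger0_norm; first exact: (score_loss_le theta K_cont K_ge0 K_le1 mM sM).
    exact: (score_loss_ge0 theta K_ge0 mM sM).
  by rewrite -(integralB measurableT iG il).
rewrite (boundE s ms sb) (boundE sopt msopt sopt_bounds).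
apply: leeB; first exact: lexx.
exact: (expected_score_loss_min theta_indep law K_cont K_ge0 mM n_gt0 ms sb msopt
  sopt_bounds score_law).
Qed.

Let mprofiles : measurable (profiles : set (n.-tuple R)).
Proof.
rewrite (_ : profiles = \bigcap_(i in [set: 'I_n]) ((fun v : n.-tuple R => tnth v i) @^-1` types)).
  apply: fin_bigcap_measurable => // i _; rewrite -[X in measurable X]setTI.
  by apply: measurable_tnth => //; exact: measurable_itv.
by apply/seteqP; split => [v h i _|v h i]; first exact: h; exact: (h i).
Qed.

Let profile_in w : profiles (profile theta w).
Proof. by move=> i; rewrite tnth_mktuple. Qed.

Let mprofile : measurable_fun setT (profile theta).
Proof.
apply/measurable_fun_tnthP => i.
rewrite (_ : _ \o _ = theta i)//; apply/funext => w; by rewrite /= tnth_mktuple.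
Qed.

Lemma measurable_revenue (q : 'I_n -> R -> R) (z : 'I_n -> n.-tuple R -> R) :
  feasible theta q z -> measurable_fun setT (fun w => \sum_(i < n)
    (V (q i (theta i w)) * z i (profile theta w)
     - vP (q i (theta i w)) (theta i w) * z i (profile theta w)
     - vI (q i (theta i w)) (theta i w))).
Proof.
move=> [mq q0 mz _ _]; have mT : measurable (types : set R) by exact: measurable_itv.
have comp i (h : R -> R) : measurable_fun types h -> measurable_fun setT (fun w => h (theta i w)).
  by move=> mh; apply: (measurable_comp mT) mh _ => // _ [w _ <-].
have mzp i : measurable_fun setT (fun w => z i (profile theta w)).
  by apply: (measurable_comp mprofiles) (mz i) mprofile => _ [w _ <-].
apply: measurable_sum => i; apply: measurable_funB; last first.
  by apply: (comp i (fun t => vI (q i t) t)); apply: vI_meas => //; exact: q0.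
apply: measurable_funB; apply: measurable_funM => //.
  by apply: (comp i (fun t => V (q i t))); apply: V_meas => //; exact: q0.
by apply: (comp i (fun t => vP (q i t) t)); apply: vP_meas => //; exact: q0.
Qed.

Lemma solution_feasible : feasible theta (fun=> qs) z_sym.
Proof.
split; [by []|by move=> _; exact: qs_ge0| |by move=> i v _; exact: ler0n|].
  2: by apply: filterS aew => w [w1 w2]; exact: z_sym_sum.
move=> i; apply: measurable_funTS.
have mtn j : measurable_fun setT (fun v : n.-tuple R => tnth v j) by exact: measurable_tnth.
have ml : measurable_fun setT (fun v : n.-tuple R => lowest_type v).
  rewrite /lowest_type; elim: (index_enum _) => [|j s IH].
    by under eq_fun do rewrite big_nil; exact: measurable_cst.
  by under eq_fun do rewrite big_cons; exact: measurable_minr.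
rewrite (_ : z_sym i = fun v : n.-tuple R => if tnth v i == lowest_type v then 1 else 0); last first.
  by apply/funext => v; rewrite /z_sym; case: eqP.
by apply: measurable_fun_ifT; [exact: measurable_fun_eqr| |]; exact: measurable_cst.
Qed.

Lemma solution_invariant : permutation_invariant (fun=> qs) (@z_sym R n).
Proof.
move=> s; split => // i v _; rewrite /z_sym tnth_mktuple; congr ((_ == _)%:R).
rewrite /lowest_type (reindex_inj (@perm_inj _ s))/=.
by apply: eq_bigr => j _; rewrite tnth_mktuple.
Qed.

Theorem solution_solves_P2 : solves_symmetric_P2 V vP vI theta (fun=> qs) z_sym.
Proof.
split; [exact: solution_feasible|exact: solution_invariant|move=> q z feas inv].
have [mq q0 mz z0 z1] := feas; pose i0 := Ordinal n_gt0.
(* The transposition of [i0] and [i] identifies their qualities; with one common quality function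
   the scores are identically distributed. *)
have qE i t : types t -> q i t = q i0 t.
  by move=> Tt; have [/(_ i0 t Tt)] := inv (tperm i0 i); rewrite tpermL.
pose s := on_interior (fun t => Num.max m (Num.min (W (q i0 t) t) M)) m.
have ms : measurable_fun setT s.
  apply: measurable_on_interior; apply: measurable_maxr; first exact: measurable_cst.
  by apply: measurable_minr; [apply: mW => //; exact: q0|exact: measurable_cst].
have sb t : m <= s t <= M.
  rewrite /s /on_interior; case: ifPn => _; last by rewrite lexx.
  by rewrite le_max lexx /= ge_max mM /= ge_min lexx orbT.
have sM t : s t <= M by case/andP: (sb t).
have oM t : sopt t <= M by case/andP: (sopt_bounds t).
rewrite /objective unlock.
apply: (@le_trans _ _ (\int[P]_w (bound s w)%:E)%E).
  apply: integral_le_ae; [exact: measurable_revenue|exact: mbound|].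
  apply: filterS2 aew z1 => w [w1 _] z1.
  apply: le_trans (revenue_le (fun t => q0 i0 t) w1 _ z1); last first.
    by move=> i; exact: z0.
  by rewrite le_eqVlt; apply/orP; left; apply/eqP; apply: eq_bigr => i _; rewrite qE.
apply: (le_trans (expected_bound_le ms sb)).
apply: integral_le_ae; [exact: mbound|exact: (measurable_revenue solution_feasible)|].
by apply: filterS aew => w [w1 w2]; exact: bound_le_revenue.
Qed.

End optimality.

(** * Existence, monotonicity and optimality of the symmetric solution *)

Theorem proposition1 (R : realType) (d : measure_display)
    (T : measurableType d) (P : probability T R)
    (n : nat) (n_gt0 : (0 < n)%N)
    (theta : 'I_n -> {RV P >-> R}) (F f : R -> R)
    (V : R -> R) (CP CI : R -> R -> R)
    (* i.i.d. types with cdf F and positive density f on [0, 1] *)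
    (theta_types : forall i w, types (theta i w))
    (theta_indep : mutually_independent theta)
    (theta_cdf : forall i x, cdf (theta i) x = (F x)%:E)
    (F_density : forall x, types x ->
       (F x)%:E = (\int[lebesgue_measure]_(t in `[0%R, x]) (f t)%:E)%E)
    (f_gt0 : forall t, types t -> 0 < f t)
    (* smoothness *)
    (f_smooth : smooth_in types 1 f)
    (V_smooth : smooth_in qualities 2 V)
    (CP_smooth : smooth_cost 3 CP)
    (CI_smooth : smooth_cost 3 CI)
    (* costs *)
    (CP_ge0 : forall q t, qualities q -> types t -> 0 <= CP q t)
    (CI_ge0 : forall q t, qualities q -> types t -> 0 <= CI q t)
    (CP_partials : forall q t, 0 < q -> t \in `]0, 1[ ->
       [/\ 0 < partial_q CP q t, 0 < partial_t CP q t &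
           0 < partial_t (partial_q CP) q t])
    (CI_partials : forall q t, 0 < q -> t \in `]0, 1[ ->
       [/\ 0 < partial_q CI q t, 0 < partial_t CI q t &
           0 < partial_t (partial_q CI) q t])
    (CI_at0 : forall t, t \in `]0, 1[ -> CI 0 t = 0 /\ partial_q CI 0 t = 0)
    (* value *)
    (V_incr : forall q, 0 < q -> 0 <= derive_in qualities V q)
    (V_concave : forall q, 0 < q ->
       derive_in qualities (derive_in qualities V) q <= 0)
    (* virtual costs *)
    (vCP_partials : forall q t, 0 < q -> t \in `]0, 1[ ->
       [/\ 0 < partial_t (virtual_cost F f CP) q t,
           0 < partial_q (partial_q (virtual_cost F f CP)) q t &
           0 <= partial_t (partial_q (virtual_cost F f CP)) q t])
    (vCI_partials : forall q t, 0 < q -> t \in `]0, 1[ ->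
       [/\ 0 < partial_t (virtual_cost F f CI) q t,
           0 < partial_q (partial_q (virtual_cost F f CI)) q t &
           0 <= partial_t (partial_q (virtual_cost F f CI)) q t])
    (V_vs_cost_at0 : forall t, types t ->
       partial_q (virtual_cost F f CP) 0 t < derive_in qualities V 0)
    (V_vs_cost_large : forall t, types t -> \forall q \near +oo,
       derive_in qualities V q <
       partial_q (virtual_cost F f CP) q t +
       partial_q (virtual_cost F f CI) q t) :
  let vCP := virtual_cost F f CP in
  let vCI := virtual_cost F f CI in
  let is_q_sym (q : R -> R) :=
    (forall t, types t -> 0 <= q t) /\
    first_order_condition n F V vCP vCI q in
  (exists q_sym, is_q_sym q_sym) /\
  (forall q_sym, is_q_sym q_sym ->
     [/\ solves_symmetric_P2 V vCP vCI theta (fun=> q_sym) z_sym,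
         (* decreasing: weakly for any number of firms, and strictly as soon
            as there are at least two firms *)
         {in `[0, 1[ &, {homo q_sym : s t /~ s <= t}} &
         (1 < n)%N -> {in `[0, 1[ &, {homo q_sym : s t /~ s < t}}]).
Proof.
move=> vCP vCI is_q_sym; pose i0 := Ordinal n_gt0.
have T0 : types (0 : R) by apply/in_types; rewrite lexx ler01.
have F1 : F 1 = 1.
  suff h : (F 1)%:E = 1%E by case: h.
  rewrite -(theta_cdf i0) -(@probability_setT _ _ _ P) /cdf /distribution /pushforward.
  congr (P _); apply/seteqP; split => // w _ /=; rewrite in_itv /=.
  by have /in_types/andP[] := theta_types i0 w.
have I t : 0 < t < 1 -> t \in `]0, 1[%R by rewrite in_itv.
have CP_t q t : 0 < q -> 0 < t < 1 -> 0 < partial_t CP q t.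
  by move=> q0 /I t01; have [] := CP_partials q t q0 t01.
have CI_t q t : 0 < q -> 0 < t < 1 -> 0 < partial_t CI q t.
  by move=> q0 /I t01; have [] := CI_partials q t q0 t01.
have CI_0 t : 0 < t < 1 -> CI 0 t = 0 by move=> /I /CI_at0[].
have CIq_0 t : 0 < t < 1 -> partial_q CI 0 t = 0 by move=> /I /CI_at0[].
have V_cont : {within qualities, continuous V} by case: V_smooth.
have solvable := first_order_solvable n F_density F1 f_gt0 f_smooth V_smooth CP_smooth CI_smooth
  CI_t CI_0 CIq_0 vCI_partials V_vs_cost_at0 V_vs_cost_large.
split.
  have ex t : exists q, 0 <= q /\ (0 <= t < 1 -> derive_in qualities V q =
      partial_q vCP q t + partial_q vCI q t / (1 - F t) ^+ n.-1).
    (* Off [[0, 1[] the condition is void, and the quality 0 satisfies the sign constraint. *)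
    have [t01|t01] := boolP (0 <= t < 1); last by exists 0; split.
    by have [q q0 qE] := solvable t t01; exists q.
  have [q qP] := choice ex; exists q; split; first by move=> t _; have [] := qP t.
  by move=> t; rewrite in_itv /= => t01; have [_] := qP t; apply.
move=> q [q0 foc'].
have foc t : 0 <= t < 1 -> derive_in qualities V (q t) =
    partial_q vCP (q t) t + partial_q vCI (q t) t / (1 - F t) ^+ n.-1.
  by move=> t01; apply: foc'; rewrite in_itv.
have nincr s t : 0 <= s -> s <= t -> t < 1 -> q t <= q s.
  exact: (solution_nincr F_density F1 f_gt0 f_smooth V_smooth CP_smooth CI_smooth
    CI_t CI_0 CIq_0 V_concave vCP_partials vCI_partials V_vs_cost_at0 q0 foc).
have decr s t : (1 < n)%N -> 0 <= s -> s < t -> t < 1 -> q t < q s.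
  exact: (solution_decr F_density F1 f_gt0 f_smooth V_smooth CP_smooth CI_smooth
    CI_t CI_0 CIq_0 V_concave vCP_partials vCI_partials V_vs_cost_at0 q0 foc).
split; last 2 first.
- move=> s t; rewrite !in_itv /= => /andP[s0 s1] /andP[t0 t1] ts.
  exact: nincr.
- move=> n1 s t; rewrite !in_itv /= => /andP[s0 s1] /andP[t0 t1] ts.
  exact: decr.
have hazard_cont := hazard_within_cont F_density f_gt0 f_smooth.
have F0 := cdf_at0 F_density.
have F_cont := cdf_within_cont F_density f_smooth.
have F_incr s t := cdf_incr F_density f_gt0 f_smooth (s := s) (t := t).
have [L _ F_lip] := cdf_lipschitz F_density f_gt0 f_smooth.
have [m m_lt] := score_lower_ex V F_density f_gt0 f_smooth CP_smooth.
have sc_decr := solution_score_decr F_density F1 f_gt0 f_smooth V_smooth CP_smooth CI_smooth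
  CI_t CI_0 CIq_0 V_concave vCP_partials vCI_partials V_vs_cost_at0 q0 foc.
have sc_le := solution_score_le F_density F1 f_gt0 f_smooth V_smooth CP_smooth CI_smooth
  CP_ge0 CP_t CI_t CI_0 CIq_0 V_incr V_concave vCP_partials vCI_partials V_vs_cost_at0 q0 foc.
have sc_gt := solution_score_gt F_density F1 f_gt0 f_smooth V_smooth CP_smooth CI_smooth
  CI_t CI_0 CIq_0 V_concave vCP_partials vCI_partials V_vs_cost_at0 q0 foc m_lt.
have mM := ltW (score_bounds F_density F1 f_gt0 f_smooth V_smooth CP_smooth CI_smooth
  CP_ge0 CP_t CI_t CI_0 CIq_0 V_incr V_concave vCP_partials vCI_partials V_vs_cost_at0
  q0 foc m_lt).
have K_cont := win_prob_continuous F_cont sc_decr.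
have A_ndecr := option_value_ndecr n F_cont F1 F_incr sc_decr m.
have A_above := solution_value_above F_density F1 f_gt0 f_smooth V_smooth CP_smooth CI_smooth
  CP_ge0 CP_t CI_t CI_0 CIq_0 V_incr V_concave vCP_partials vCI_partials V_vs_cost_at0
  q0 foc m_lt.
have net := solution_net_value_le F_density F1 f_gt0 f_smooth V_smooth CP_smooth CI_smooth
  CI_t CI_0 CIq_0 V_concave vCP_partials vCI_partials V_vs_cost_at0 q0 foc m_lt.
have q_gt0 := solution_gt0 F_density CI_smooth CI_t CI_0 CIq_0 V_vs_cost_at0 q0 foc.
apply: (@solution_solves_P2 R d T P n theta F V vCP vCI q m (score_upper V q) L) => //.
- by move=> u mu u0; exact: measurable_within_qualities V_cont mu u0.
- by move=> u mu u0; exact: (measurable_virtual_cost hazard_cont CP_smooth mu u0).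
- by move=> u mu u0; exact: (measurable_virtual_cost hazard_cont CI_smooth mu u0).
- exact: measurable_nonincreasing_types.
- by move=> t t01; apply/ltW/sc_gt.
- by move=> r; exact: win_prob_ge0.
- by move=> r; exact: win_prob_le1.
- by move=> t t01; exact: virtual_investment_at0.
- move=> t /andP[t0 t1]; apply: (virtual_cost_ge0 F_density f_gt0 f_smooth CI_ge0 CI_t).
    by apply: q_gt0; rewrite t1 ltW.
  by rewrite t0.
Qed.
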